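(* Let $a_1,\ldots,a_M$ be distinct points of $\mathbb D$ and let $b(z)=\prod_{\ell=1}^M\frac{z-a_\ell}{1-za_\ell^*}$. Let $$C=\begin{pmatrix}1&1&\cdots&1\end{pmatrix}\in\mathbb C^{1\times M},\qquad A=\mathrm{diag}(a_1^*,a_2^*,\ldots,a_M^* )\in\mathbb C^{M\times M},$$ and let $P\in\mathbb C^{M\times M}$ be the positive definite matrix with entries $$P_{\ell j}=\frac{1}{1-a_\ell a_j^*},\qquad \ell,j=1,\ldots,M.$$ Let $u=\begin{pmatrix}u_1&u_2&\cdots&u_M\end{pmatrix}\in\mathbb C^{1\times M}$ and $\gamma\in\mathbb C$ be preassigned. Then for a function $h$ on $\mathbb D$ the following are equivalent: (1) $h\in\mathbf H_2$, $\sum_{\ell=1}^M u_\ell h(a_\ell)=\gamma$ and $\|h\|_{\mathbf H_2}\le1$. (2) $h$ is of the form $$h(z)=C(I_M-zA)^{-1}P^{-1/2}\sigma_1(b(z))\bigl(1-b(z)\sigma_2(b(z))\bigr)^{-1},\qquad z\in\mathbb D,$$ where $\sigma=\begin{pmatrix}\sigma_1\\ \sigma_2\end{pmatrix}\in\mathscr S^{(M+1)\times1}$, with $\sigma_1$ being $\mathbb C^{M}$-valued and $\sigma_2$ scalar-valued, is such that $$\begin{pmatrix}uP^{1/2}&0\end{pmatrix}\sigma(0)=\gamma.$$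
   Context: $\mathbb D$ is the open unit disk and $\mathbf H_2$ is the Hardy space of $\mathbb D$: functions $f(z)=\sum_{n\ge 0}f_nz^n$ with $\|f\|_{\mathbf H_2}^2=\sum_{n\ge0}|f_n|^2<\infty$. The superscript $*$ denotes complex conjugate (of a number) or conjugate transpose (of a matrix). $\mathscr S^{(M+1)\times1}$ denotes the set of Schur functions, i.e. $\mathbb C^{M+1}$-valued functions (column vectors) that are analytic and contractive (Euclidean norm at most $1$) in $\mathbb D$. $P^{1/2}$ is the positive definite square root of $P$ and $P^{-1/2}$ its inverse. *)

(* Defs.v *)
From HB Require Import structures.
From mathcomp Require Import all_boot all_order all_algebra.
From mathcomp Require Import complex.
From mathcomp Require Import all_classical all_reals all_analysis.
Set Implicit Arguments.
Unset Strict Implicit.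
Unset Printing Implicit Defensive.
Import Order.TTheory GRing.Theory Num.Theory.
Import numFieldNormedType.Exports.
Import ComplexField.Normc.
Local Open Scope classical_set_scope.
Local Open Scope ring_scope.
Local Open Scope sesquilinear_scope.

(* Functions on the open unit disk are represented by total functions on R[i];
   [hardy2], [hardy2_norm] and [schur] only depend on the values on [unit_disk]. *)
Definition unit_disk (R : realType) : set R[i] := [set z | `|z| < 1].

(* R[i] carries its norm topology under the alias R[i]^o. *)
Definition power_series_sum (R : realType) (c : nat -> R[i]) (w s : R[i]) : Prop :=
  (series (fun n => c n * w ^+ n) : nat -> R[i]^o) @ \oo --> (s : R[i]^o).

(* Meant for open U: the radius r can always be shrunk so that the ball lies
   in U, hence the values of f outside U are irrelevant. *)
Definition analytic_on (R : realType) (U : set R[i]) (f : R[i] -> R[i]) : Prop :=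
  forall z0, U z0 ->
    exists2 r : R[i], 0 < r &
      exists c : nat -> R[i],
        forall z, `|z - z0| < r -> power_series_sum c (z - z0) (f z).

Definition disk_expansion (R : realType) (h : R[i] -> R[i]) (c : nat -> R[i]) : Prop :=
  forall z, unit_disk z -> power_series_sum c z (h z).

Definition sum_sq (R : realType) (c : nat -> R[i]) : nat -> R :=
  series (fun n => normc (c n) ^+ 2).

Definition hardy2 (R : realType) : set (R[i] -> R[i]) :=
  [set h : R[i] -> R[i] | exists2 c, disk_expansion h c & cvgn (sum_sq c)].

(* The expansion is unique when it exists, so the choice made by [xget] is
   immaterial. *)
Definition hardy2_norm (R : realType) (h : R[i] -> R[i]) : R :=
  Num.sqrt (limn (sum_sq (xget (fun=> 0) (disk_expansion h)))).

Definition enorm (R : realType) (n : nat) (v : 'cV[R[i]]_n) : R :=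
  Num.sqrt (\sum_(i < n) normc (v i 0) ^+ 2).

Definition schur (R : realType) (n : nat) : set (R[i] -> 'cV[R[i]]_n) :=
  [set s : R[i] -> 'cV[R[i]]_n | (forall i, analytic_on (@unit_disk R) (fun z => s z i 0)) /\
           (forall z, unit_disk z -> enorm (s z) <= 1)].

(* In the partial order of R[i], 0 < x means that x is real and positive. *)
Definition posdefmx (R : realType) (n : nat) (Q : 'M[R[i]]_n) : Prop :=
  Q \is hermsymmx /\
  forall x : 'cV[R[i]]_n, x != 0 -> 0 < (x ^t* *m Q *m x) 0 0.

Definition posdef_sqrtmx (R : realType) (n : nat) (P : 'M[R[i]]_n) : 'M[R[i]]_n :=
  xget 0 [set Q | posdefmx Q /\ Q *m Q = P].

(* Main.v *)
(* Let b be the Blaschke product and K x = C (I - zA)^-1 P^-1/2 x.  The columns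
   of K form an orthonormal basis of the orthogonal complement of b H_2, since P
   is the Gram matrix of the Szego kernels at the zeros of b.  Peeling off
   h = K x_0 + b h_1, h_1 = K x_1 + b h_2, ... turns the unit ball of H_2 into
   that of the C^M-valued Hardy space: h(z) = K(z) F(b(z)) with
   F = sum_k x_k w^k, and h(a_l) only depends on x_0 = F(0).  It remains to see
   that the latter ball consists of the functions F = sigma_1 / (1 - w sigma_2)
   with (sigma_1, sigma_2) a Schur function.  Given F, let T be the backward
   shift and alpha(w) = sum_n <T^(n+1) F, F> w^n; the energy balance of
   y = (1 - w T)^-1 F gives |F|^2 + |alpha|^2 <= |1 + w alpha|^2, and one takes
   sigma_1 = F / (1 + w alpha), sigma_2 = alpha / (1 + w alpha).  Conversely, a
   Schur function contracts the coefficients of q = 1 / (1 - w sigma_2), and the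
   resulting inequality telescopes because q = 1 + w sigma_2 q. *)
Require Import Defs.
From HB Require Import structures.
From mathcomp Require Import all_boot all_order all_algebra.
From mathcomp Require Import complex.
From mathcomp Require Import all_classical all_reals all_analysis.
From mathcomp Require Import cyclic separable cyclotomic.
From mathcomp Require Import ring lra zify.
Set Implicit Arguments.
Unset Strict Implicit.
Unset Printing Implicit Defensive.
Import Order.TTheory GRing.Theory Num.Theory.
Import numFieldNormedType.Exports.
Import ComplexField.Normc.
Local Open Scope classical_set_scope.
Local Open Scope ring_scope.

(** The argument uses neither contour integrals nor a Hilbert space. Norm bounds are bounds on all
    partial sums, and the norm identities are proved for truncations whose boundary term is
    nonnegative or tends to 0. The contraction of coefficients by a Schur function comes from a
    maximum principle, obtained by averaging over four points, and from Parseval's identity over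
    roots of unity. The inequality for alpha arises as follows. The coefficient of y at 0 is F(w),
    so |F(w)|^2 = |y|^2 - |T y|^2. Since y = F + w T y and <T y, F> = alpha(w), also |y|^2 = |F|^2 +
    |w|^2 |T y|^2 + 2 Re(w alpha(w)). As |F| <= 1, Cauchy-Schwarz gives |alpha(w)| <= |T y|, hence
    |F(w)|^2 <= 1 - (1 - |w|^2) |alpha(w)|^2 + 2 Re(w alpha(w)), and the right side is |1 + w
    alpha(w)|^2 - |alpha(w)|^2. *)

Local Notation re := (@complex.Re _).
Local Notation im := (@complex.Im _).

(** * Complex sequences *)

Section ComplexModulus.
Context {R : realType}.
Implicit Types (x y z : R[i]) (e : R).

Lemma normc_normE z : `|z| = (normc z)%:C%C.
Proof. by case: z. Qed.

Lemma normc_ge0 z : 0 <= normc z.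
Proof. by case: z => a b; exact: sqrtr_ge0. Qed.

Lemma ler_normcD x y : normc (x + y) <= normc x + normc y.
Proof. exact: le_normcD. Qed.

Lemma normcNE x : normc (- x) = normc x.
Proof. exact: normcN. Qed.

Lemma normc_distC x y : normc (x - y) = normc (y - x).
Proof. by rewrite -normcNE opprB. Qed.

Lemma ler_normcB x y : normc (x - y) <= normc x + normc y.
Proof. by rewrite (le_trans (ler_normcD _ _))// normcNE. Qed.

Lemma normcX z n : normc (z ^+ n) = normc z ^+ n.
Proof.
by elim: n => [|n IH]; rewrite ?expr0 ?normc1// !exprS normcM IH.
Qed.

Lemma normc_real e : normc e%:C%C = `|e|.
Proof. by rewrite /normc /= expr0n addr0 sqrtr_sqr. Qed.

Lemma normc_eq0 z : (normc z == 0) = (z == 0).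
Proof.
apply/eqP/eqP => [|->]; [exact: eq0_normc|exact: normc0].
Qed.

Lemma normc_gt0 z : (0 < normc z) = (z != 0).
Proof. by rewrite lt_neqAle normc_ge0 andbT eq_sym normc_eq0. Qed.

Lemma normcJE z : normc z^* = normc z.
Proof. by case: z => a b /=; rewrite sqrrN. Qed.

Lemma normc_sqrE z : ((normc z ^+ 2)%:C)%C = z * z^*.
Proof. by rewrite rmorphXn /= -normc_normE normCK. Qed.

Lemma normc_sqrRe z : normc z ^+ 2 = re (z * z^*).
Proof. by rewrite -normc_sqrE. Qed.

Lemma ReD x y : re (x + y) = re x + re y.
Proof. by case: x; case: y. Qed.

Lemma ReN x : re (- x) = - re x.
Proof. by case: x. Qed.

Lemma ImD x y : im (x + y) = im x + im y.
Proof. by case: x; case: y. Qed.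

Lemma ImN x : im (- x) = - im x.
Proof. by case: x. Qed.

Lemma ler_Re_normc z : `|re z| <= normc z.
Proof.
case: z => a b /=; rewrite -sqrtr_sqr ler_wsqrtr// lerDl; exact: sqr_ge0.
Qed.

Lemma ler_Im_normc z : `|im z| <= normc z.
Proof.
case: z => a b /=; rewrite -sqrtr_sqr ler_wsqrtr// lerDr; exact: sqr_ge0.
Qed.

Lemma ler_normc_ReIm z : normc z <= `|re z| + `|im z|.
Proof.
case: z => a b /=; rewrite -(@ger0_norm _ (`|a| + `|b|)) ?addr_ge0//.
rewrite -sqrtr_sqr ler_wsqrtr// sqrrD !real_normK ?num_real//.
by rewrite -addrA lerD2l lerDr mulrn_wge0// mulr_ge0.
Qed.

Lemma normc_sqrD x y :
  normc (x + y) ^+ 2 = normc x ^+ 2 + normc y ^+ 2 + 2 * re (x^* * y).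
Proof.
case: x => a b; case: y => c d; rewrite /= !sqr_sqrtr ?addr_ge0 ?sqr_ge0//.
by rewrite mulNr opprK; ring.
Qed.

Lemma ler_normc_sum (I : Type) (s : seq I) (P : pred I) (F : I -> R[i]) :
  normc (\sum_(i <- s | P i) F i) <= \sum_(i <- s | P i) normc (F i).
Proof.
elim/big_ind2: _ => [|x a y b xa yb|//]; first by rewrite normc0.
by rewrite (le_trans (ler_normcD _ _))// lerD.
Qed.

Lemma Re_sum (I : Type) (s : seq I) (P : pred I) (F : I -> R[i]) :
  re (\sum_(i <- s | P i) F i) = \sum_(i <- s | P i) re (F i).
Proof.
by elim/big_rec2: _ => // i x y _ <-; rewrite ReD.
Qed.

Lemma unit_diskE z : unit_disk z <-> normc z < 1.
Proof. by rewrite /unit_disk/= normc_normE ltcR. Qed.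

End ComplexModulus.

(** * Limits of complex sequences *)

Section ComplexLimits.
Context {R : realType}.
Implicit Types (u v : nat -> R[i]) (z l : R[i]) (e : R).

(** Real epsilons keep the partial order of [R[i]] out of the estimates; [tendsP] is the bridge to
    the filter version. *)
Definition tends u l := forall e, 0 < e ->
  exists K, forall n, (K <= n)%N -> normc (u n - l) < e.

Lemma tendsP u l :
  ((u : nat -> R[i]^o) @ \oo --> (l : R[i]^o)) <-> tends u l.
Proof.
split=> [ul e e0|ul].
  have e0' : 0 < (e%:C)%C by rewrite ltcR.
  move/cvgrPdist_lt : ul => /(_ _ e0')[K _ Kul]; exists K => n /Kul /=.
  by rewrite normc_normE ltcR normc_distC.
apply/cvgrPdist_lt => -[e e'] /=; rewrite ltcE/= => /andP[/eqP -> e0].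
have [K Kul] := ul _ e0; exists K => // n /Kul /=.
by rewrite normc_normE ltcR normc_distC.
Qed.

Lemma tends_unique u l l' : tends u l -> tends u l' -> l = l'.
Proof. by move=> /tendsP ul /tendsP; exact: (cvg_unique _ ul). Qed.

Lemma tends_cst l : tends (fun=> l) l.
Proof. by move=> e e0; exists 0%N => n _; rewrite subrr normc0. Qed.

Lemma tendsD u v l l' : tends u l -> tends v l' ->
  tends (fun n => u n + v n) (l + l').
Proof.
move=> ul vl e e0; have e20 : 0 < e / 2 by rewrite divr_gt0.
have [[K Ku] [L Lv]] := (ul _ e20, vl _ e20).
exists (maxn K L) => n; rewrite geq_max => /andP[/Ku Kn /Lv Ln].
by rewrite opprD addrACA [e]splitr (le_lt_trans (ler_normcD _ _))// ltrD.
Qed.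

Lemma tendsZ u l z : tends u l -> tends (fun n => z * u n) (z * l).
Proof.
move=> ul e e0; have z0 : 0 < normc z + 1 by rewrite ltr_wpDl// normc_ge0.
have [K Ku] := ul _ (divr_gt0 e0 z0); exists K => n /Ku un.
rewrite -mulrBr normcM (@le_lt_trans _ _ ((normc z + 1) * normc (u n - l)))//.
  by rewrite ler_wpM2r ?normc_ge0// lerDl.
by rewrite mulrC -ltr_pdivlMr.
Qed.

Lemma tends_eq u v l : (forall n, u n = v n) -> tends u l -> tends v l.
Proof. by move=> /funext ->. Qed.

Lemma tends_shiftV u l : tends (fun n => u n.+1) l -> tends u l.
Proof.
by move=> ul e /ul[K Kul]; exists K.+1 => -[//|n] Kn; exact: Kul.
Qed.

Lemma tends_normc_sqr u l : tends u l ->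
  tends (fun n => (normc (u n) ^+ 2)%:C%C) ((normc l ^+ 2)%:C%C).
Proof.
move=> ul e e0; have L0 : 0 < 1 + 2 * normc l.
  by rewrite ltr_wpDr// mulr_ge0 ?normc_ge0.
(* Where |u n - l| <= 1, the two squares differ by at most |u n - l| (1 + 2 |l|). *)
have [|K Ku] := ul (Num.min 1 (e / (1 + 2 * normc l))).
  by rewrite lt_min ltr01 divr_gt0.
exists K => n /Ku; rewrite lt_min => /andP[d1 de].
have uE : normc (u n) ^+ 2 - normc l ^+ 2 =
    normc (u n - l) ^+ 2 + 2 * re ((u n - l)^* * l).
  by have := normc_sqrD (u n - l) l; rewrite subrK => ->; rewrite addrAC addrK.
rewrite -rmorphB normc_real uE.
move: (u n - l) d1 de => v v1; rewrite ltr_pdivlMr// => ve.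
rewrite (le_lt_trans _ ve)// (le_trans (ler_normD _ _))// mulrDr mulr1.
rewrite ger0_norm ?sqr_ge0// lerD//.
  by rewrite expr2 ler_piMr ?normc_ge0// ltW.
rewrite normrM ger0_norm// mulrCA ler_pM2l// (le_trans (ler_Re_normc _))//.
by rewrite normcM normcJE.
Qed.

Lemma tends_Re_le u v l l' : tends u l -> tends v l' ->
  (forall n, re (u n) <= re (v n)) -> re l <= re l'.
Proof.
move=> ul vl uv; apply/ler_addgt0Pr => e e0.
have e20 : 0 < e / 2 by rewrite divr_gt0.
have [[K Ku] [L Lv]] := (ul _ e20, vl _ e20); pose n := maxn K L.
have := le_lt_trans (ler_Re_normc _) (Ku n (leq_maxl _ _)).
have := le_lt_trans (ler_Re_normc _) (Lv n (leq_maxr _ _)).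
rewrite !ReD !ReN !ltr_norml => /andP[_ h1] /andP[h2 _]; have := uv n; lra.
Qed.

Lemma tends_normc_le u l e :
  tends u l -> (forall n, normc (u n) <= e) -> normc l <= e.
Proof.
move=> ul ue; apply/ler_addgt0Pr => d /ul[K /(_ _ (leqnn _)) Kul].
rewrite -[l](subKr (u K)) (le_trans (ler_normcB _ _))//.
by rewrite lerD// ltW.
Qed.

Lemma tends_sum (I : Type) (s : seq I) (F : I -> nat -> R[i]) (G : I -> R[i]) :
  (forall i, tends (F i) (G i)) ->
  tends (fun n => \sum_(i <- s) F i n) (\sum_(i <- s) G i).
Proof.
move=> FG; elim: s => [|i s IH].
  by rewrite big_nil; apply: tends_eq (tends_cst _) => n; rewrite big_nil.
rewrite big_cons; apply: tends_eq (tendsD (FG i) IH) => n.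
by rewrite big_cons.
Qed.

Lemma tends_cauchy u :
  (forall e, 0 < e -> exists K, forall m n, (K <= m)%N -> (K <= n)%N ->
     normc (u m - u n) < e) -> exists l, tends u l.
Proof.
move=> cu.
have cR (f : R[i] -> R) : (forall x y : R[i], f (x - y) = f x - f y) ->
    (forall z, `|f z| <= normc z) -> cvgn (f \o u).
  move=> fB fn; apply/cauchy_cvgP/cauchyP => e /cu[K Ku].
  exists (f (u K)) => /=; exists K => // n /= Kn.
  by rewrite /ball/= -fB (le_lt_trans (fn _))// Ku.
have ReB (x y : R[i]) : re (x - y) = re x - re y by rewrite ReD ReN.
have ImB (x y : R[i]) : im (x - y) = im x - im y by rewrite ImD ImN.
have /cvg_ex[a ua] := cR (@complex.Re R) ReB ler_Re_normc.
have /cvg_ex[b ub] := cR (@complex.Im R) ImB ler_Im_normc.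
exists (a +i* b)%C => e e0.
have e20 : 0 < e / 2 by rewrite divr_gt0.
move/cvgrPdist_lt : ua => /(_ _ e20)[K _ Ka].
move/cvgrPdist_lt : ub => /(_ _ e20)[L _ Lb].
exists (maxn K L) => n; rewrite geq_max => /andP[/Ka/= Kn /Lb/= Ln].
rewrite (le_lt_trans (ler_normc_ReIm _))// [e]splitr ltrD//.
  by rewrite ReB distrC.
by rewrite ImB distrC.
Qed.

Lemma expr_small (r e : R) : 0 <= r < 1 -> 0 < e ->
  exists K, forall n, (K <= n)%N -> r ^+ n < e.
Proof.
move=> /andP[r0 r1] e0.
have : `|r| < 1 by rewrite ger0_norm.
move=> /cvg_expr /cvgrPdist_lt /(_ _ e0)[K _ Kr]; exists K => n /Kr /=.
by rewrite sub0r normrN ger0_norm ?exprn_ge0.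
Qed.

Lemma sum_geo_le (r : R) n : 0 <= r < 1 -> \sum_(k < n) r ^+ k <= (1 - r)^-1.
Proof.
move=> /andP[r0 r1]; have r1' : 0 < 1 - r by rewrite subr_gt0.
rewrite -[leRHS]mul1r ler_pdivlMr// mulrC -opprB mulNr -subrX1 opprB.
by rewrite gerBl exprn_ge0.
Qed.

End ComplexLimits.

(** * Power series with bounded coefficients *)

Section PowerSeries.
Context {R : realType}.
Implicit Types (c d : nat -> R[i]) (z w a : R[i]) (B : R).

Definition psum c z n : R[i] := \sum_(k < n) c k * z ^+ k.

Definition cbounded B c := forall n, normc (c n) <= B.

(* Junk value 0 if the series diverges. *)
Definition ev c z : R[i] := xget 0 [set s | tends (psum c z) s].

Lemma power_series_sumP c z s : power_series_sum c z s <-> tends (psum c z) s.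
Proof.
rewrite /power_series_sum tendsP.
by split; apply: tends_eq => n; rewrite /psum /series/= big_mkord.
Qed.

Lemma ev_eq c z s : tends (psum c z) s -> ev c z = s.
Proof.
move=> cs; apply: (@tends_unique _ (psum c z)) => //.
by rewrite /ev; case: xgetP => // /(_ s).
Qed.

Lemma cbounded_ge0 B c : cbounded B c -> 0 <= B.
Proof. by move=> /(_ 0%N); apply: le_trans; exact: normc_ge0. Qed.

Lemma cbounded_shift B c m : cbounded B c -> cbounded B (fun n => c (m + n)%N).
Proof. by move=> cB n; exact: cB. Qed.

Lemma psum_bound B c z n : cbounded B c -> normc z < 1 ->
  normc (psum c z n) <= B / (1 - normc z).
Proof.
move=> cB z1; rewrite (le_trans (ler_normc_sum _ _ _))//.
apply: (@le_trans _ _ (\sum_(k < n) B * normc z ^+ k)).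
  by apply: ler_sum => k _; rewrite normcM normcX ler_wpM2r ?exprn_ge0
    ?normc_ge0.
by rewrite -mulr_sumr ler_wpM2l ?(cbounded_ge0 cB)// sum_geo_le// normc_ge0.
Qed.

Lemma psum_split c z n m :
  psum c z (n + m) = psum c z n + z ^+ n * psum (fun k => c (n + k)%N) z m.
Proof.
rewrite /psum big_split_ord/=; congr (_ + _); rewrite mulr_sumr.
by apply: eq_bigr => k _; rewrite exprD mulrCA.
Qed.

Lemma psumS c z n : psum c z n.+1 = c 0%N + z * psum (fun k => c k.+1) z n.
Proof.
by rewrite -add1n psum_split {1}/psum big_ord1 expr0 mulr1 expr1.
Qed.

Lemma ev_tends B c z : cbounded B c -> normc z < 1 ->
  tends (psum c z) (ev c z).
Proof.
move=> cB z1; suff [l cl] : exists l, tends (psum c z) l by rewrite (ev_eq cl).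
apply: tends_cauchy => e e0; have z1' : 0 < 1 - normc z by rewrite subr_gt0.
have B0 : 0 < B + 1 by rewrite ltr_wpDl// (cbounded_ge0 cB).
(* The part of the series after K is z^K times a partial sum bounded by B / (1 - |z|); B + 1 makes
   the divisor positive. *)
have [||K Kz] := @expr_small _ (normc z) (e / 2 / ((B + 1) / (1 - normc z))).
- by rewrite normc_ge0.
- by rewrite !divr_gt0.
suff h n : (K <= n)%N -> normc (psum c z n - psum c z K) < e / 2.
  exists K => m n /h Km /h; rewrite normc_distC => Kn.
  by rewrite -(subrKA (psum c z K)) [e]splitr (le_lt_trans (ler_normcD _ _))
    ?ltrD.
move=> Kn; rewrite -(subnKC Kn) psum_split addrAC subrr add0r normcM normcX.
have := Kz K (leqnn _); rewrite ltr_pdivlMr ?divr_gt0//; apply: le_lt_trans.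
rewrite ler_wpM2l ?exprn_ge0 ?normc_ge0// (@le_trans _ _ (B / (1 - normc z)))//.
  exact/psum_bound/z1/cbounded_shift.
by rewrite ler_wpM2r ?invr_ge0 ?(ltW z1')// lerDl.
Qed.

Lemma ev_bound B c z : cbounded B c -> normc z < 1 ->
  normc (ev c z) <= B / (1 - normc z).
Proof.
move=> cB z1; apply: tends_normc_le (ev_tends cB z1) _ => n.
exact: psum_bound.
Qed.

Lemma ev_shift B c z : cbounded B c -> normc z < 1 ->
  ev c z = c 0%N + z * ev (fun n => c n.+1) z.
Proof.
move=> cB z1; apply/ev_eq/tends_shiftV.
apply: (@tends_eq _ (fun n => c 0%N + z * psum (fun k => c k.+1) z n)).
  by move=> n; rewrite psumS.
exact/tendsD/tendsZ/(ev_tends (cbounded_shift 1 cB) z1)/tends_cst.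
Qed.

Lemma evD B B' c d z : cbounded B c -> cbounded B' d -> normc z < 1 ->
  ev (fun n => c n + d n) z = ev c z + ev d z.
Proof.
move=> cB dB z1; apply: ev_eq.
apply: tends_eq (tendsD (ev_tends cB z1) (ev_tends dB z1)) => n.
by rewrite /psum -big_split; apply: eq_bigr => k _; rewrite mulrDl.
Qed.

Lemma evZ B c z a : cbounded B c -> normc z < 1 ->
  ev (fun n => a * c n) z = a * ev c z.
Proof.
move=> cB z1; apply: ev_eq; apply: tends_eq (tendsZ a (ev_tends cB z1)) => n.
by rewrite /psum mulr_sumr; apply: eq_bigr => k _; rewrite mulrA.
Qed.

Lemma evB B B' c d z : cbounded B c -> cbounded B' d -> normc z < 1 ->
  ev (fun n => c n - d n) z = ev c z - ev d z.
Proof.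
move=> cB dB z1; rewrite -mulN1r -(evZ _ dB z1) -(evD (B := B) (B' := B'))//.
  by congr ev; apply/funext => n; rewrite mulN1r.
by move=> n; rewrite mulN1r normcNE.
Qed.

Lemma ev_sum (I : Type) (s : seq I) B (c : I -> nat -> R[i]) z :
  (forall i, cbounded B (c i)) -> normc z < 1 ->
  ev (fun n => \sum_(i <- s) c i n) z = \sum_(i <- s) ev (c i) z.
Proof.
move=> cB z1; apply: ev_eq.
apply: tends_eq (tends_sum s (fun i => ev_tends (cB i) z1)) => n.
by rewrite /psum exchange_big; apply: eq_bigr => k _; rewrite mulr_suml.
Qed.

Lemma ev_at0 c : ev c 0 = c 0%N.
Proof.
apply/ev_eq/tends_shiftV; apply: tends_eq (tends_cst _) => n.
by rewrite psumS mul0r addr0.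
Qed.

(* Coefficients of the difference quotient (ev c z - ev c a) / (z - a). *)
Definition quot c a n := ev (fun k => c (n.+1 + k)%N) a.

Lemma quot_bounded B c a : cbounded B c -> normc a < 1 ->
  cbounded (B / (1 - normc a)) (quot c a).
Proof. by move=> cB a1 n; exact/ev_bound/a1/cbounded_shift. Qed.

Lemma quot_rec B c a n : cbounded B c -> normc a < 1 ->
  quot c a n = c n.+1 + a * quot c a n.+1.
Proof.
move=> cB a1; rewrite {1}/quot (ev_shift (cbounded_shift _ cB) a1) addn0.
by congr (_ + _ * ev _ _); apply/funext => k; rewrite !addSn addnS.
Qed.

Lemma quot_rec0 B c a : cbounded B c -> normc a < 1 ->
  ev c a = c 0%N + a * quot c a 0.
Proof. exact: ev_shift. Qed.

Lemma ev_quot B c a z : cbounded B c -> normc a < 1 -> normc z < 1 ->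
  ev c z = ev c a + (z - a) * ev (quot c a) z.
Proof.
move=> cB a1 z1; have qB := quot_bounded cB a1.
rewrite (ev_shift cB z1) [ev c a](ev_shift cB a1).
have -> : ev (fun n => c n.+1) z
    = ev (quot c a) z - a * ev (fun n => quot c a n.+1) z.
  have qB' : cbounded (B / (1 - normc a)) (fun n => quot c a n.+1).
    by move=> n; exact: qB.
  rewrite -(evZ a qB' z1) -(evB (B' := normc a * (B / (1 - normc a))) qB _ z1).
    by congr ev; apply/funext => n; rewrite (quot_rec _ cB a1) addrK.
  by move=> n; rewrite normcM ler_wpM2l ?normc_ge0.
rewrite (_ : ev (fun n => c n.+1) a = quot c a 0)//.
have := ev_shift qB z1; move: (ev _ z) (ev _ z) (quot c a 0) => x y t ->; ring.
Qed.

(** The first coefficient is -z times a bounded quantity for small nonzero z, so it is 0; dividing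
    by z then starts over with the shifted series. The point z = 0 is left out of the hypothesis so
    that it survives this division. *)
Lemma ev_eq0 B c (r : R) : cbounded B c -> 0 < r -> r < 1 ->
  (forall z, 0 < normc z < r -> ev c z = 0) -> forall n, c n = 0.
Proof.
move=> cB r0 r1 c0 n.
have head0 d : cbounded B d -> (forall z, 0 < normc z < r -> ev d z = 0) ->
    d 0%N = 0.
    move=> dB d0; apply/eqP; rewrite -normc_eq0 eq_le normc_ge0 andbT.
  apply/ler_addgt0Pr => e e0; rewrite add0r; have B0 : 0 < B / (1 - r) + 1.
    by rewrite ltr_wpDl// divr_ge0 ?(cbounded_ge0 dB)// subr_ge0 ltW.
  pose t := Num.min (r / 2) (e / (B / (1 - r) + 1)).
  have t0 : 0 < t by rewrite lt_min !divr_gt0.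
  have tr : t < r by rewrite gt_min ltr_pdivrMr// mulr_natr mulr2n ltrDr r0.
  have nt : normc t%:C%C = t by rewrite normc_real gtr0_norm.
  have := ev_shift dB (_ : normc t%:C%C < 1).
  rewrite nt (lt_trans tr r1) d0 ?nt ?t0// => /(_ isT)/esym/eqP.
  rewrite addr_eq0 => /eqP ->; rewrite normcNE normcM nt.
  apply: (@le_trans _ _ (t * (B / (1 - r) + 1))).
    rewrite ler_wpM2l ?(ltW t0)//.
    rewrite (le_trans (ev_bound (cbounded_shift 1 dB) _)) ?nt ?(lt_trans tr
      r1)//.
    rewrite ler_wpDr// ler_wpM2l ?(cbounded_ge0 dB)//
      lef_pV2 ?posrE ?subr_gt0//.
      by rewrite lerD2l lerN2 ltW.
    exact: lt_trans tr r1.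
  by rewrite -ler_pdivlMr// ge_min lexx orbT.
elim: n c cB c0 => [|n IH] c cB c0; first exact: head0.
apply: (IH (fun k => c k.+1)) => [k|z zr]; first exact: cB.
have /andP[z0 zr'] := zr; rewrite normc_gt0 in z0.
apply: (mulfI z0); rewrite mulr0; apply: (addrI (c 0%N)).
by rewrite -(ev_shift cB) ?(lt_trans zr')// (c0 _ zr) head0 ?addr0.
Qed.

Lemma ev_inj B B' c d (r : R) :
  cbounded B c -> cbounded B' d -> 0 < r -> r < 1 ->
  (forall z, normc z < r -> ev c z = ev d z) -> c = d.
Proof.
move=> cB dB r0 r1 cd; apply/funext => n; apply/eqP; rewrite -subr_eq0;
  apply/eqP.
apply: (@ev_eq0 (B + B') (fun n => c n - d n) r) => // [k|z /andP[_ zr]].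
  by rewrite (le_trans (ler_normcB _ _)) ?lerD.
by rewrite (evB cB dB) ?(lt_trans zr r1)// cd// subrr.
Qed.

(** The Cauchy condition is uniform in the index j of the coefficients, so the values at z differ by
    at most the sup distance divided by 1 - |z|. *)
Lemma ev_uniform_limit B (c : nat -> nat -> R[i]) :
  (forall m, cbounded B (c m)) ->
  (forall e, 0 < e -> exists K, forall m n j, (K <= m)%N -> (K <= n)%N ->
     normc (c m j - c n j) < e) ->
  exists d, [/\ cbounded B d, forall j, tends (c^~ j) (d j) &
    forall z, normc z < 1 -> tends (fun m => ev (c m) z) (ev d z)].
Proof.
move=> cB cc.
have /choice[d cd] : forall j, exists l, tends (c^~ j) l.
  move=> j; apply: tends_cauchy => e /cc[K Kc]; exists K => m n Km Kn.
  exact: Kc.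
have dB : cbounded B d by move=> j; apply: tends_normc_le (cd j) _ => n;
  exact: cB.
exists d; split=> // z z1 e e0.
have z1' : 0 < 1 - normc z by rewrite subr_gt0.
have e1 : 0 < e * (1 - normc z) / 2 by rewrite divr_gt0// mulr_gt0.
have [K Kc] := cc _ e1; exists K => m Km; rewrite -(evB (cB m) dB z1).
have h : cbounded (e * (1 - normc z) / 2) (fun n => c m n - d n).
  move=> j; apply: (@tends_normc_le _ (fun n => c m j - c (K + n)%N j)).
    apply: tendsD (tends_cst _) _.
    apply: (@tends_eq _ (fun n => -1 * c (K + n)%N j)) => [n|].
      by rewrite mulN1r.
    rewrite -[- d j]mulN1r; apply: tendsZ => t /(cd j)[L Lc].
    by exists L => n Ln; apply: Lc; rewrite (leq_trans Ln)// leq_addl.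
  by move=> n; apply/ltW/Kc => //; exact: leq_addr.
rewrite (le_lt_trans (ev_bound h z1))// mulrAC mulfK ?gt_eqF//.
by rewrite ltr_pdivrMr// mulr_natr mulr2n ltrDl.
Qed.

End PowerSeries.

(** * Iterated difference quotients and analyticity *)

Section DifferenceQuotients.
Context {R : realType}.
Implicit Types (f g : R[i] -> R[i]) (z w : R[i]) (c : nat -> R[i]) (B : R).

(* Analyticity is traded for Caratheodory's form of differentiability, iterated
   k times, because the latter is visibly stable under products and inverses.
   Only the values of f near z0 matter (diffq_congr). *)
Fixpoint diffq (k : nat) f z0 : Prop :=
  if k is k'.+1 then
    exists2 g, diffq k' g z0 & forall z, f z = f z0 + (z - z0) * g z
  else exists B (e : R), 0 < e /\
    forall z, normc (z - z0) < e -> normc (f z) <= B.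

(** The defining equation is required at every z, not only near z0, so the quotient function is
    redefined off z0 as the difference quotient of f'. *)
Lemma diffq_congr k f f' z0 (e : R) : 0 < e ->
  (forall z, normc (z - z0) < e -> f z = f' z) -> diffq k f z0 -> diffq k f' z0.
Proof.
move=> e0; elim: k f f' => [|k IH] f f' ff' /=.
  move=> [B [d [d0 fB]]]; exists B, (Num.min e d); rewrite lt_min e0 d0.
  by split=> // z; rewrite lt_min => /andP[ze zd]; rewrite -ff'// fB.
move=> [g gk fg]; exists
  (fun z => if z == z0 then g z else (f' z - f' z0) / (z - z0)).
  apply: IH gk => z ze; case: eqVneq => // zz0.
  rewrite -(ff' _ ze) -ff' ?subrr ?normc0// fg addrAC subrr add0r mulrAC.
  by rewrite divff ?mul1r// subr_eq0.
move=> z; case: eqVneq => [->|zz0]; first by rewrite subrr mul0r addr0.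
by rewrite mulrC divfK ?subr_eq0// addrC subrK.
Qed.

Lemma diffqS k f g z0 (e : R) : 0 < e -> diffq k g z0 ->
  (forall z, normc (z - z0) < e -> f z = f z0 + (z - z0) * g z) ->
  diffq k.+1 f z0.
Proof.
move=> e0 gk fg; apply: (@diffq_congr _
  (fun z => f z0 + (z - z0) * g z) _ _ e) => //.
  by move=> z /fg.
by exists g => // z; rewrite subrr mul0r addr0.
Qed.

Lemma diffqW k f z0 : diffq k.+1 f z0 -> diffq k f z0.
Proof.
elim: k f => [|k IH] f [g gk fg]; last by exists g => //; exact: IH.
have [B [e [e0 gB]]] := gk; exists (normc (f z0) + e * B), e; split=> // z ze.
rewrite fg (le_trans (ler_normcD _ _))// lerD2l normcM.
rewrite (le_trans (ler_wpM2l (normc_ge0 _) (gB _ ze)))//.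
by rewrite ler_wpM2r ?(ltW ze)// (le_trans (normc_ge0 _) (gB _ ze)).
Qed.

Lemma diffq_leq k m f z0 : (k <= m)%N -> diffq m f z0 -> diffq k f z0.
Proof. by move=> /subnKC <-; elim: (m - k)%N => [|d IH];
  rewrite ?addn0// addnS => /diffqW. Qed.

Lemma diffq_cst k z0 (c : R[i]) : diffq k (fun=> c) z0.
Proof.
elim: k c => [|k IH] c; first by exists (normc c), 1.
by exists (fun=> 0) => // z; rewrite mulr0 addr0.
Qed.

Lemma diffqD k f g z0 : diffq k f z0 -> diffq k g z0 ->
  diffq k (fun z => f z + g z) z0.
Proof.
elim: k f g => [|k IH] f g /=.
  move=> [B [d [d0 fB]]] [B' [d' [d0' gB]]]; exists (B + B'), (Num.min d d').
  rewrite lt_min d0 d0'; split=> // z; rewrite lt_min => /andP[zd zd'].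
  by rewrite (le_trans (ler_normcD _ _))// lerD// ?fB ?gB.
move=> [F Fk fF] [G Gk gG]; exists (fun z => F z + G z); first exact: IH.
by move=> z; rewrite fF gG mulrDr addrACA.
Qed.

Lemma diffqM k f g z0 : diffq k f z0 -> diffq k g z0 ->
  diffq k (fun z => f z * g z) z0.
Proof.
elim: k f g => [|k IH] f g.
  move=> [B [d [d0 fB]]] [B' [d' [d0' gB]]]; exists (B * B'), (Num.min d d').
  rewrite lt_min d0 d0'; split=> // z; rewrite lt_min => /andP[zd zd'].
  by rewrite normcM ler_pM ?normc_ge0 ?fB ?gB.
move=> [F Fk fF] gk; have gk' := diffqW gk; case: gk => G Gk gG.
exists (fun z => f z0 * G z + F z * g z).
  by apply: diffqD; [apply: IH => //; exact: diffq_cst|exact: IH].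
by move=> z; rewrite fF gG; ring.
Qed.

Lemma diffq_comp_affine k f z0 s t :
  diffq k f (s * z0 + t) -> diffq k (fun z => f (s * z + t)) z0.
Proof.
elim: k f => [|k IH] f /=.
  move=> [B [d [d0 fB]]]; have s0 : 0 < normc s + 1
    by rewrite ltr_wpDl ?normc_ge0.
  exists B, (d / (normc s + 1)); split; first by rewrite divr_gt0.
  move=> z; rewrite ltr_pdivlMr// => zd; apply: fB.
  have -> : s * z + t - (s * z0 + t) = s * (z - z0) by ring.
  by rewrite normcM mulrC (le_lt_trans _ zd)// ler_wpM2l ?normc_ge0// lerDl.
move=> [g gk fg]; exists (fun z => s * g (s * z + t)).
  apply: diffqM; [exact: diffq_cst|exact: IH].
by move=> z; rewrite fg; ring.
Qed.

Lemma diffq_id k z0 : diffq k id z0.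
Proof.
apply: (@diffqW k); exists (fun=> 1); first exact: diffq_cst.
by move=> z; rewrite mulr1 addrC subrK.
Qed.

Lemma diffq_sum k (I : Type) (s : seq I) (F : I -> R[i] -> R[i]) z0 :
  (forall i, diffq k (F i) z0) -> diffq k (fun z => \sum_(i <- s) F i z) z0.
Proof.
move=> Fk; elim: s => [|i s IH].
  by apply: (@diffq_congr _ (fun=> 0) _ _ 1) (diffq_cst k z0 0) => // z;
    rewrite big_nil.
apply: (@diffq_congr _ _ _ _ 1) (diffqD (Fk i) IH) => // z _.
by rewrite big_cons.
Qed.

Lemma diffq_exp k f n z0 : diffq k f z0 -> diffq k (fun z => f z ^+ n) z0.
Proof.
move=> fk; elim: n => [|n IH].
  by apply: (@diffq_congr _ (fun=> 1) _ _ 1) (diffq_cst k z0 1).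
by apply: (@diffq_congr _ _ _ _ 1) (diffqM fk IH) => // z _; rewrite exprS.
Qed.

Lemma diffq_continuous f z0 (e : R) : diffq 1 f z0 -> 0 < e ->
  exists2 d : R, 0 < d & forall z, normc (z - z0) < d -> normc (f z - f z0) < e.
Proof.
move=> [g [B [d [d0 gB]]] fg] e0.
have B0 : 0 <= B by rewrite (le_trans (normc_ge0 (g z0)))// gB// subrr normc0.
exists (Num.min d (e / (B + 1)));
  first by rewrite lt_min d0 divr_gt0// ltr_wpDl.
move=> z; rewrite lt_min => /andP[zd]; rewrite ltr_pdivlMr ?ltr_wpDl// => ze.
rewrite fg addrAC subrr add0r normcM (le_lt_trans _ ze)//.
by rewrite ler_wpM2l ?normc_ge0// (le_trans (gB _ zd))// lerDl.
Qed.

(** One order is spent on continuity, which keeps f away from 0 near z0. If F is the quotient of f,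
    that of 1 / f is - F / (f z0 * f). *)
Lemma diffqV k f z0 : diffq k.+1 f z0 -> f z0 != 0 -> diffq k
  (fun z => (f z)^-1) z0.
Proof.
move=> fk f0; have nf0 : 0 < normc (f z0) / 2 by rewrite divr_gt0// normc_gt0.
have [d d0 fd] := diffq_continuous (diffq_leq (isT : 1 <= k.+1)%N fk) nf0.
have fn z : normc (z - z0) < d -> normc (f z0) / 2 <= normc (f z).
  move=> /fd zd; have := ler_normcB (f z0) (f z0 - f z).
  rewrite subKr normc_distC in zd *.
  have := ler_normcD (f z) (f z0 - f z); rewrite addrC subrK.
  lra.
elim: k fk => [|k IH] fk.
  exists (normc (f z0) / 2)^-1, d; split=> // z /fn zd.
  by rewrite normcV lef_pV2// posrE (lt_le_trans nf0).
have [F Fk fF] := fk.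
apply: (@diffqS _ _ (fun z => - (f z0)^-1 * (F z * (f z)^-1)) _ d) => //.
  apply: diffqM; first exact: diffq_cst.
  by apply: diffqM; [exact: diffqW|apply: IH; exact: diffqW].
move=> z zd; have fz0 : f z != 0 by rewrite -normc_gt0 (lt_le_trans nf0) ?fn.
have e : (z - z0) * F z = f z - f z0 by rewrite [f z]fF addrAC subrr add0r.
rewrite mulrCA [X in _ * X]mulrA e; field; exact/andP.
Qed.

(** The difference quotient of a series with bounded coefficients is again one, so the induction on
    k stays in this class. *)
Lemma diffq_ev k B c z0 : cbounded B c -> normc z0 < 1 -> diffq k (ev c) z0.
Proof.
move=> + z1; elim: k B c => [|k IH] B c cB.
  have z1' : 0 < (1 - normc z0) / 2 by rewrite divr_gt0// subr_gt0.
  exists (B / ((1 - normc z0) / 2)), ((1 - normc z0) / 2); split=> // z ze.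
  have zle : (1 - normc z0) / 2 <= 1 - normc z.
    have := ler_normcD (z - z0) z0; rewrite subrK; lra.
  have z1'' : normc z < 1 by rewrite -subr_gt0 (lt_le_trans z1').
  rewrite (le_trans (ev_bound cB z1''))// ler_wpM2l ?(cbounded_ge0 cB)//.
  by rewrite lef_pV2// posrE ?(lt_le_trans z1').
apply: (@diffqS _ _ (ev (quot c z0)) _ (1 - normc z0)); rewrite ?subr_gt0//.
  exact/IH/quot_bounded/z1.
move=> z ze; apply: ev_quot cB z1 _.
by have := ler_normcD (z - z0) z0; rewrite subrK; lra.
Qed.

(** The terms of a series that converges at s are bounded there, so after rescaling by s the results
    on bounded coefficients apply. *)
Lemma ev_rescale c f (r s : R) : 0 < s -> s < r ->
  (forall v, normc v < r -> tends (psum c v) (f v)) ->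
  exists2 B, cbounded B (fun n => c n * s%:C%C ^+ n) &
    forall w, normc w < 1 -> f (s%:C%C * w) = ev (fun n => c n * s%:C%C ^+ n) w.
Proof.
move=> s0 sr cf; have ns : normc s%:C%C = s by rewrite normc_real gtr0_norm.
have cs : tends (psum c s%:C%C) (f s%:C%C) by apply: cf; rewrite ns.
have [K Kc] := cs 1 ltr01.
(* Two consecutive partial sums, each within 1 of the limit, differ by less than 2; the finitely
   many earlier terms are bounded by their sum. *)
have cK n : (K <= n)%N -> normc (c n * s%:C%C ^+ n) < 2.
  move=> Kn; have := Kc _ Kn; have := Kc _ (leqW Kn).
  rewrite /psum big_ord_recr/= => h1 h2.
  set x := \sum_(_ < _) _ in h1 h2; set y := c n * _ in h1 *.
  have -> : y = (x + y - f s%:C%C) - (x - f s%:C%C) by ring.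
  by rewrite (le_lt_trans (ler_normcB _ _))// -[2]/(1 + 1) ltrD.
exists (2 + \sum_(k < K) normc (c k * s%:C%C ^+ k)).
  move=> n; have [/cK/ltW Kn|nK] := leqP K n.
    by rewrite (le_trans Kn)// lerDl sumr_ge0// => i _; exact: normc_ge0.
  rewrite (bigD1 (Ordinal nK))//= addrCA lerDl addr_ge0//.
  by rewrite sumr_ge0// => i _; exact: normc_ge0.
move=> w w1; apply/esym/ev_eq.
apply: (@tends_eq _ (psum c (s%:C%C * w))).
  by move=> n; apply: eq_bigr => k _; rewrite exprMn mulrA.
apply: cf; rewrite normcM ns (le_lt_trans _ sr)//.
by rewrite ler_piMr ?(ltW s0)// ltW.
Qed.

(** All orders are required because inverses and difference quotients lose some. *)
Definition smooth f := forall k z, normc z < 1 -> diffq k f z.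

Lemma smooth_ev B c : cbounded B c -> smooth (ev c).
Proof. by move=> cB k z z1; exact: diffq_ev cB z1. Qed.

Lemma smooth_cst (c : R[i]) : smooth (fun=> c). Proof. by move=> k z _;
  exact: diffq_cst. Qed.

Lemma smooth_id : smooth id. Proof. by move=> k z _; exact: diffq_id. Qed.

Lemma smoothD f g : smooth f -> smooth g -> smooth (fun z => f z + g z).
Proof. by move=> sf sg k z z1; apply: diffqD; [exact: sf|exact: sg]. Qed.

Lemma smoothM f g : smooth f -> smooth g -> smooth (fun z => f z * g z).
Proof. by move=> sf sg k z z1; apply: diffqM; [exact: sf|exact: sg]. Qed.

Lemma smooth_exp f n : smooth f -> smooth (fun z => f z ^+ n).
Proof. by move=> sf k z z1; apply: diffq_exp; exact: sf. Qed.

Lemma smooth_sum (I : Type) (s : seq I) (F : I -> R[i] -> R[i]) :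
  (forall i, smooth (F i)) -> smooth (fun z => \sum_(i <- s) F i z).
Proof. by move=> sF k z z1; apply: diffq_sum => i; exact: sF. Qed.

Lemma smoothV f : smooth f -> (forall z, normc z < 1 -> f z != 0) ->
  smooth (fun z => (f z)^-1).
Proof. by move=> sf f0 k z z1; apply: diffqV; [exact: sf|exact: f0]. Qed.

Lemma smooth_rot f w : normc w = 1 -> smooth f -> smooth (fun z => f (z * w)).
Proof.
move=> w1 sf k z z1.
apply: (@diffq_congr _ (fun z => f (w * z + 0)) _ _ 1) => //.
  by move=> y _; rewrite addr0 mulrC.
by apply/diffq_comp_affine/sf; rewrite addr0 normcM w1 mul1r.
Qed.

Lemma smooth_eq f g : (forall z, normc z < 1 -> f z = g z) ->
  smooth f -> smooth g.
Proof.
move=> fg sf k z z1; apply: (@diffq_congr _ f _ _ (1 - normc z)).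
- by rewrite subr_gt0.
- by move=> y yz; apply: fg; have := ler_normcD (y - z) z; rewrite subrK; lra.
- exact: sf.
Qed.

Lemma analytic_smooth f : analytic_on (@unit_disk R) f -> smooth f.
Proof.
move=> af k z0 /unit_diskE/af[r r0 [c cf]].
have [s s0 rs] : exists2 s : R, 0 < s & r = s%:C%C.
  case: r r0 {cf} => a b; rewrite ltcE/= => /andP[/eqP -> a0].
  by exists a.
have cf' v : normc v < s -> tends (psum c v) (f (v + z0)).
  move=> vs; apply/power_series_sumP; rewrite -{1}(addrK z0 v); apply: cf.
  by rewrite addrK rs normc_normE ltcR.
have s20 : 0 < s / 2 by rewrite divr_gt0.
have [|B cB fE] := ev_rescale s20 _ cf';
  first by rewrite ltr_pdivrMr// mulr_natr mulr2n ltrDr.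
set t : R[i] := (s / 2)%:C%C in cB fE.
have t0 : t != 0 by rewrite -normc_gt0 normc_real normr_gt0 gt_eqF.
apply: (@diffq_congr _ (fun z => ev
  (fun n => c n * t ^+ n) (t^-1 * z + - (t^-1 * z0))) _ _ (s / 2)) => //.
  move=> z zs; rewrite -fE; first by rewrite -mulrBr mulrA divff// mul1r subrK.
  rewrite -mulrBr normcM normcV normc_real gtr0_norm// mulrC.
  by rewrite ltr_pdivrMr// mul1r.
by apply/diffq_comp_affine; rewrite subrr; apply: diffq_ev cB _; rewrite normc0.
Qed.

(** The coefficients at z0 are the values at z0 of the iterated quotients [q n]. Each quotient
    multiplies the bound by 1 / (1 - |z0|), so the remainder is of order (|z - z0| / (1 -
    |z0|))^n. *)
Lemma ev_analytic f B c : cbounded B c ->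
  (forall z, normc z < 1 -> f z = ev c z) -> analytic_on (@unit_disk R) f.
Proof.
move=> cB fE z0 /unit_diskE z1; have z1' : 0 < 1 - normc z0 by rewrite subr_gt0.
exists ((1 - normc z0)%:C%C); first by rewrite ltcR.
pose q n := iter n (quot^~ z0) c.
pose r := (1 - normc z0)^-1.
have qB n : cbounded (B * r ^+ n) (q n).
  elim: n => [|n IH]; first by rewrite expr0 mulr1.
  by rewrite exprSr mulrA; exact: quot_bounded.
exists (fun n => ev (q n) z0) => z; rewrite normc_normE ltcR => zs.
have zz : normc z < 1 by have := ler_normcD (z - z0) z0; rewrite subrK; lra.
have evE n : f z = psum (fun n => ev (q n) z0) (z - z0) n
                      + (z - z0) ^+ n * ev (q n) z.
  elim: n => [|n IH].
    by rewrite fE// /psum big_ord0 add0r expr0 mul1r.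
  rewrite IH /psum big_ord_recr/= -addrA; congr (_ + _).
  by rewrite (ev_quot (qB n) z1 zz) mulrDr mulrC exprSr mulrA.
apply/power_series_sumP => e e0.
have B0 : 0 < (B + 1) / (1 - normc z).
  by rewrite divr_gt0 ?subr_gt0// ltr_wpDl// (cbounded_ge0 cB).
have [||K Kz] := @expr_small _ (normc (z - z0) * r) (e / ((B + 1) /
  (1 - normc z))).
- rewrite mulr_ge0 ?normc_ge0 ?invr_ge0 ?(ltW z1')//=.
  by rewrite ltr_pdivrMr// mul1r.
- by rewrite divr_gt0.
exists K => n /Kz; rewrite ltr_pdivlMr// => h;
  rewrite (evE n) opprD addrA subrr.
rewrite add0r normcNE normcM normcX (le_lt_trans _ h)// exprMn -mulrA.
rewrite ler_wpM2l ?exprn_ge0 ?normc_ge0//.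
rewrite (le_trans (ev_bound (qB n) zz))//
  mulrA ler_wpM2r ?invr_ge0 ?subr_ge0 ?(ltW zz)//.
by rewrite mulrC ler_wpM2l ?exprn_ge0 ?invr_ge0 ?(ltW z1')// lerDl.
Qed.

End DifferenceQuotients.

(** * The maximum principle *)

Section MaximumPrinciple.
Context {R : realType}.
Implicit Types (f g : R[i] -> R[i]) (z w : R[i]).

Lemma normc_nat n : normc (n%:R : R[i]) = n%:R.
Proof. by rewrite [LHS](normcMn (1 : R[i])) normc1. Qed.

Lemma ler_dist_normc z w : `|normc z - normc w| <= normc (z - w).
Proof.
rewrite ler_norml; have := ler_normcD (z - w) w; have := ler_normcD (w - z) z.
rewrite !subrK (normc_distC w z); lra.
Qed.

Lemma parallelogram_normc z w :
  normc (z + w) ^+ 2 + normc (z - w) ^+ 2 = 2 * (normc z ^+ 2 + normc w ^+ 2).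
Proof.
by rewrite !normc_sqrD normcNE mulrN ReN; ring.
Qed.

(* The mean over the four points z0 + s i^k cancels the terms of degree 1 and 2,
   which replaces the mean value property over a circle. *)
Lemma diffq_mean4 f z0 : diffq 3 f z0 ->
  exists B (d : R), [/\ 0 < d, 0 <= B & forall s : R, 0 < s < d ->
    4 * normc (f z0) <= normc (f (z0 + s%:C%C)) + normc (f (z0 - s%:C%C))
      + (normc (f (z0 + s *i)%C) + normc (f (z0 - s *i)%C)) + 4 * B * s ^+ 3].
Proof.
move=> [f1 [f2 [f3 [B [d [d0 f3B]]] f2E] f1E] fE].
have B0 : 0 <= B by rewrite (le_trans (normc_ge0 (f3 z0)))// f3B// subrr normc0.
exists B, d; split=> // s /andP[s0 sd].
have fE' v : f (z0 + v) = f z0 + v * f1 z0 + v ^+ 2 * f2 z0 + v ^+ 3 * f3 (z0 +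
  v).
  by rewrite fE f1E f2E addrAC subrr add0r; ring.
have f3B' v : normc v = s -> normc (v ^+ 3 * f3 (z0 + v)) <= B * s ^+ 3.
  move=> vs; rewrite normcM normcX vs mulrC ler_wpM2r ?exprn_ge0 ?(ltW s0)//.
  by apply: f3B; rewrite addrAC subrr add0r vs.
set a := (s%:C)%C; set b := (s *i)%C.
have na : normc a = s by rewrite normc_real gtr0_norm.
have ab : b ^+ 2 = - a ^+ 2.
  by rewrite /a /b !expr2; simpc.
have nb : normc b = s.
  by rewrite /b /normc /= expr0n add0r sqrtr_sqr gtr0_norm.
have E : 4 * f z0 = f (z0 + a) + f (z0 - a) + (f (z0 + b) + f (z0 - b))
   - (a ^+ 3 * f3 (z0 + a) + (- a) ^+ 3 * f3 (z0 - a)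
     + (b ^+ 3 * f3 (z0 + b) + (- b) ^+ 3 * f3 (z0 - b))).
  by rewrite !fE' !sqrrN ab; ring.
have -> : 4 * normc (f z0) = normc (4 * f z0).
  by rewrite normcM normc_nat.
rewrite E; clear E.
have h (x y : R[i]) : normc (x + y) <= normc x + normc y := ler_normcD x y.
rewrite (le_trans (ler_normcB _ _))// lerD//.
  by rewrite (le_trans (h _ _))// lerD// h.
rewrite (le_trans (h _ _))//.
apply: (@le_trans _ _ ((B * s ^+ 3 + B * s ^+ 3) + (B * s ^+ 3 + B * s ^+ 3))).
  by apply: lerD; rewrite (le_trans (h _ _))// lerD// f3B' ?normcNE.
by rewrite le_eqVlt; apply/orP; left; apply/eqP; ring.
Qed.

(** The disk is read as a closed subset of a square in R * R, hence compact. *)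
Lemma normc_disk_EVT (phi : R[i] -> R) (r : R) : 0 <= r ->
  (forall z, normc z <= r -> forall e : R, 0 < e -> exists2 d : R, 0 < d &
     forall w, normc (w - z) < d -> `|phi w - phi z| < e) ->
  exists2 c, normc c <= r & forall z, normc z <= r -> phi z <= phi c.
Proof.
move=> r0 phic.
pose K : set (R * R) := [set p | p.1 ^+ 2 + p.2 ^+ 2 <= r ^+ 2].
have KE p : K p <-> normc (p.1 +i* p.2)%C <= r.
  rewrite /K /= -[X in _ <-> _ <= X]ger0_norm// -[X in _ <-> _ <= X]sqrtr_sqr.
  by rewrite ler_sqrt ?sqr_ge0.
have cK : compact K.
  apply: (@subclosed_compact _ _ (`[- r, r] `*` `[- r, r])).
  - pose q (p : R * R) : R := p.1 ^+ 2 + p.2 ^+ 2.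
    have cq : continuous q.
      move=> p; apply: cvgD; apply: cvgM; try exact: cvg_fst; exact: cvg_snd.
    have := @closed_comp _ _ q [set x | x <= r ^+ 2] (fun p _ => cq p).
    by apply; exact: closed_le.
  - by apply: compact_setX; exact: segment_compact.
  - move=> [x y] /= xy.
    have h (t : R) : t ^+ 2 <= r ^+ 2 -> - r <= t <= r.
      by move=> tr; rewrite -ler_norml -(ger0_norm r0) -ler_sqr ?nnegrE//
        !real_normK ?num_real.
    rewrite !in_itv /= !h//; rewrite (le_trans _ xy)//.
      by rewrite lerDr sqr_ge0.
    by rewrite lerDl sqr_ge0.
have [||c cKc cmax] := @compact_EVT_max _ R
  (fun p => phi (p.1 +i* p.2)%C) K _ cK.
- by exists (0, 0); rewrite /K/= !expr0n addr0 sqr_ge0.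
- apply: continuous_in_subspaceT => p; rewrite inE => /KE pr.
  apply/cvgrPdist_lt => e e0; have [d d0 dp] := phic _ pr _ e0.
  have d20 : 0 < d / 2 by rewrite divr_gt0.
  have : nbhs p (ball p.1 (d / 2) `*` ball p.2 (d / 2)).
    by exists (ball p.1 (d / 2), ball p.2 (d / 2)) => //; split;
      exact: nbhsx_ballx.
  apply: filterS => q [q1 q2]; rewrite distrC; apply: dp.
  rewrite (le_lt_trans (ler_normc_ReIm _))//= [d]splitr ltrD//.
    by rewrite distrC.
  by rewrite distrC.
exists (c.1 +i* c.2)%C; first by apply/KE; rewrite inE in cKc.
by move=> [x y] xy; apply: (cmax (x, y)); rewrite inE; apply/KE.
Qed.

Lemma maximum_principle g (r B : R) : 0 < r < 1 ->
  (forall z, normc z < 1 -> diffq 3 g z) ->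
  (forall z, normc z = r -> normc (g z) <= B) ->
  forall z, normc z <= r -> normc (g z) <= B.
Proof.
move=> /andP[r0 r1] sg gB z zr; apply/ler_addgt0Pr => e0 e00.
(* Scaled so that the perturbation e |w|^2 equals e0 on the circle of radius r. *)
pose e := e0 / (r ^+ 2); have e1 : 0 < e by rewrite divr_gt0 ?exprn_gt0.
have eE : e * r ^+ 2 = e0 by rewrite divfK// expf_neq0// gt_eqF.
clearbody e.
(* phi is strictly subharmonic, so it has no maximum inside the disk. *)
pose phi w := normc (g w) + e * normc w ^+ 2.
have [||c cr cmax] := @normc_disk_EVT phi r; first exact: ltW.
  move=> w wr d d0; have w1 := le_lt_trans wr r1.
  have d20 : 0 < d / 2 by rewrite divr_gt0.
  have [t t0 gt] := diffq_continuous (diffq_leq (isT : 1 <= 3)%N (sg _ w1)) d20.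
  have [t' t0' wt] := diffq_continuous (diffq_exp 2 (diffq_id 1 w))
    (divr_gt0 d20 e1).
  exists (Num.min t t') => [|v]; first by rewrite lt_min t0.
  rewrite lt_min => /andP[/gt gv /wt wv]; rewrite /phi opprD addrACA -mulrBr.
  rewrite (le_lt_trans (ler_normD _ _))// [d]splitr ltrD//.
    exact: le_lt_trans (ler_dist_normc _ _) gv.
  rewrite normrM gtr0_norm// mulrC -ltr_pdivlMr// (le_lt_trans _ wv)//.
  by rewrite -!normcX ler_dist_normc.
(* At an interior maximum, adding the four inequalities phi (c + v) <= phi c and using [diffq_mean4]
   gives 4 e s^2 <= 4 M s^3, which fails once M s < e. *)
have cE : normc c = r.
  apply/eqP; rewrite eq_le cr /= leNgt; apply/negP => cr'.
  have [M [d [d0 M0 hM]]] := diffq_mean4 (sg _ (le_lt_trans cr r1)).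
  pose s := Num.min (Num.min (d / 2) (r - normc c)) (e / (M + 1) / 2).
  have M1 : 0 < M + 1 by rewrite ltr_wpDl.
  have s0 : 0 < s by rewrite !lt_min subr_gt0 cr' !divr_gt0.
  have sd : s < d.
    by rewrite !gt_min ltr_pdivrMr// mulr_natr mulr2n ltrDr d0.
  have sr : normc c + s <= r.
    by rewrite -lerBrDl !ge_min lexx orbT.
  have se : M * s < e.
    apply: (@le_lt_trans _ _ ((M + 1) * (e / (M + 1) / 2))).
      apply: ler_pM; rewrite ?(ltW s0) ?lerDl//.
      by rewrite ge_min lexx orbT.
    have -> : (M + 1) * (e / (M + 1) / 2) = e / 2 by field; rewrite gt_eqF.
    rewrite ltr_pdivrMr//.
    by rewrite mulr_natr mulr2n ltrDr.
  have /hM : 0 < s < d by rewrite s0.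
  have in_disk v : normc v = s -> normc (c + v) <= r.
    by move=> vs; rewrite (le_trans (ler_normcD _ _))// vs.
  have na : normc s%:C%C = s by rewrite normc_real gtr0_norm.
  have nb : normc (s *i)%C = s.
    by rewrite /normc /= expr0n add0r sqrtr_sqr gtr0_norm.
  have := cmax _ (in_disk _ na); have := cmax _ (in_disk (- _) (etrans
    (normcNE _) na)).
  have := cmax _ (in_disk _ nb); have := cmax _ (in_disk (- _) (etrans
    (normcNE _) nb)).
  rewrite /phi.
  have P : normc (c + s%:C%C) ^+ 2 + normc (c - s%:C%C) ^+ 2 +
      (normc (c + (s *i)%C) ^+ 2 + normc (c - (s *i)%C) ^+ 2)
      = 4 * normc c ^+ 2 + 4 * s ^+ 2.
    by rewrite !parallelogram_normc na nb; ring.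
  have : s * (M * s ^+ 2) < e * s ^+ 2.
    by rewrite mulrCA mulrA ltr_pM2r ?exprn_gt0.
  rewrite exprSr.
  nra.
rewrite (le_trans _ (_ : phi c <= _))//.
  rewrite (le_trans _ (cmax z zr))// /phi lerDl mulr_ge0 ?(ltW e1)//.
  exact: exprn_ge0 (normc_ge0 _).
by rewrite /phi lerD ?gB// cE eE.
Qed.

End MaximumPrinciple.

(** * Taylor coefficients of bounded functions *)

Section Taylor.
Context {R : realType}.
Implicit Types (f g rho : R[i] -> R[i]) (z w : R[i]) (c : nat -> R[i]) (B : R).

Lemma diffq_eq_at g g' z0 : diffq 1 g z0 -> diffq 1 g' z0 ->
  (forall z, z != z0 -> g z = g' z) -> g z0 = g' z0.
Proof.
move=> g1 g1' gg; apply/eqP; rewrite -subr_eq0 -normc_eq0 eq_le normc_ge0 andbT.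
apply/ler_addgt0Pr => e e0; rewrite add0r;
  have e20 : 0 < e / 2 by rewrite divr_gt0.
have [d d0 gd] := diffq_continuous g1 e20.
have [d' d0' gd'] := diffq_continuous g1' e20.
pose t := Num.min d d' / 2; have t0 : 0 < t by rewrite divr_gt0// lt_min d0.
have tm : t < Num.min d d' by rewrite ltr_pdivrMr//
  mulr_natr mulr2n ltrDr lt_min d0.
pose z := z0 + t%:C%C.
have nz : normc (z - z0) = t by rewrite addrAC subrr add0r normc_real gtr0_norm.
have zz : z != z0 by rewrite -subr_eq0 -normc_gt0 nz.
move: tm; rewrite lt_min -nz => /andP[/gd h1 /gd' h2].
have -> : g z0 - g' z0 = (g' z - g' z0) - (g z - g z0) by rewrite (gg z zz);
  ring.
by rewrite (le_trans (ler_normcB _ _))// [e]splitr ltW// ltrD.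
Qed.

(** The quotient g obtained at order 2 coincides with the one obtained at order k + 2: off 0 by the
    equation, at 0 by continuity. So g has every order at 0; elsewhere it is an explicit
    quotient. *)
Lemma smooth_quot0 f : smooth f ->
  exists2 g, smooth g & forall z, f z = f 0 + z * g z.
Proof.
move=> sf; have n0 : normc (0 : R[i]) < 1 by rewrite normc0.
have [g g1 fg] := sf 2 0 n0; exists g; last by move=> z; rewrite fg subr0.
move=> k z z1; have [->|z0] := eqVneq z 0.
  have [h hk fh] := sf k.+2 0 n0.
  have gh y : y != 0 -> h y = g y.
    move=> y0; apply: (mulfI y0); apply: (addrI (f 0)).
    by rewrite -[X in X * h y]subr0 -fh -[X in X * g y]subr0 -fg.
  suff -> : g = h by exact: diffqW.
  apply/funext => y; apply/esym; have [->|/gh//] := eqVneq y 0.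
  by apply: diffq_eq_at => //; exact: (diffq_leq (isT : 1 <= k.+1)%N).
apply: (@diffq_congr _ _ (fun y => (f y + - f 0) * y^-1) _ _ (normc z)).
- by rewrite normc_gt0.
- move=> y yz; have y0 : y != 0.
    by apply: contraTneq yz => ->; rewrite sub0r normcNE ltxx.
  by rewrite fg subr0 addrAC subrr add0r mulrAC divff// mul1r.
- apply: diffqM; last by apply: diffqV => //; exact: diffq_id.
  by apply: diffqD; [exact: sf|exact: diffq_cst].
Qed.

(** Finite expansions with a smooth remainder; convergence comes only in [taylor_ev], once the
    coefficients are known to be bounded. *)
Definition taylor f c := forall n, exists2 rho, smooth rho &
  forall z, f z = psum c z n + z ^+ n * rho z.

Lemma smooth_taylor f : smooth f -> exists c, taylor f c.
Proof.
move=> sf.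
have /choice[T TP] : forall g, exists h, smooth g ->
    smooth h /\ forall z, g z = g 0 + z * h z.
  move=> g; have [/smooth_quot0[h sh gh]|ng] := pselect (smooth g).
    by exists h.
  by exists g.
pose F n := iter n T f; have sF n : smooth (F n).
  by elim: n => [//|n IH]; have [] := TP _ IH.
exists (fun n => F n 0) => n; exists (F n) => // z.
elim: n => [|n ->]; first by rewrite /psum big_ord0 add0r expr0 mul1r.
rewrite /psum big_ord_recr/= -addrA; congr (_ + _).
by have [_ ->] := TP _ (sF n); rewrite -/(F n.+1) mulrDr exprSr mulrA mulrC.
Qed.

(** On a circle of radius r > |z| the remainder factor is at most D / r^n. The maximum principle
    carries this bound to z, where the error becomes (|z| / r)^n D. *)
Lemma taylor_ev f B c : cbounded B c -> taylor f c ->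
  (forall r : R, 0 < r < 1 -> exists M, forall z,
    normc z = r -> normc (f z) <= M) ->
  forall z, normc z < 1 -> f z = ev c z.
Proof.
move=> cB fc fM z z1; apply/esym/ev_eq.
pose r := (1 + normc z) / 2; have n0 := normc_ge0 z.
have r01 : 0 < r < 1 by apply/andP; split; rewrite /r; lra.
have zr : normc z < r by rewrite /r; lra.
have /andP[r0 r1] := r01.
have [M fMr] := fM _ r01; pose D := M + B / (1 - r).
have D0 : 0 <= D.
  have nr : normc r%:C%C = r by rewrite normc_real gtr0_norm.
  rewrite addr_ge0 ?divr_ge0 ?(cbounded_ge0 cB) ?subr_ge0 ?(ltW r1)//.
  exact: le_trans (normc_ge0 _) (fMr _ nr).
have bound n : normc (psum c z n - f z) <= (normc z / r) ^+ n * D.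
  have [rho srho frho] := fc n.
  have rhoD y : normc y = r -> normc (rho y) <= D / r ^+ n.
    move=> yr; rewrite ler_pdivlMr ?exprn_gt0// -yr mulrC -normcX -normcM.
    have -> : y ^+ n * rho y = f y - psum c y n by rewrite frho; ring.
    rewrite (le_trans (ler_normcB _ _))// lerD ?fMr//.
    by rewrite -yr psum_bound// yr.
  have := maximum_principle r01 (srho 3) rhoD (ltW zr).
  rewrite frho opprD addrA subrr add0r normcNE normcM normcX => h.
  rewrite exprMn exprVn -mulrA ler_wpM2l ?exprn_ge0// (le_trans h)//.
  by rewrite mulrC.
move=> e e0; have D1 : 0 < D + 1 by rewrite ltr_wpDl.
have [||K Kz] := @expr_small _ (normc z / r) (e / (D + 1)).
- by rewrite divr_ge0 ?(ltW r0)//= ltr_pdivrMr// mul1r.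
- by rewrite divr_gt0.
exists K => n /Kz; rewrite ltr_pdivlMr// => h.
rewrite (le_lt_trans (bound n))// (le_lt_trans _ h)//.
by rewrite ler_wpM2l ?lerDl// exprn_ge0// divr_ge0// ltW.
Qed.

End Taylor.

(** * Contraction of coefficients through roots of unity *)

Section CoefficientContraction.
Context {R : realType}.
Implicit Types (f g rho : R[i] -> R[i]) (z w : R[i]) (c : nat -> R[i]).

Lemma prim_root_exists n : (0 < n)%N -> exists w : R[i], n.-primitive_root w.
Proof.
move=> n0; have [rs] := closed_field_poly_normal ('X^n - 1 : {poly R[i]}).
rewrite (monicP (monicXnsubC _ n0)) scale1r => Drs.
have rs1 : all n.-unity_root rs.
  by apply/allP => x; rewrite -root_prod_XsubC -Drs.
have urs : uniq rs.
  by rewrite -separable_prod_XsubC -Drs separable_Xn_sub_1// pnatr_eq0 -lt0n.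
have srs : (n <= size rs)%N.
  by rewrite -ltnS -(size_prod_XsubC rs id) -Drs size_XnsubC.
by have /hasP[w _ wn] := has_prim_root n0 rs1 urs srs; exists w.
Qed.

Lemma prim_root_normc n w : n.-primitive_root w -> normc w = 1.
Proof.
move=> wn; have := prim_expr_order wn => /(congr1 (@normc R)).
rewrite normcX normc1 => /eqP; rewrite pexpr_eq1 ?normc_ge0 ?(prim_order_gt0
  wn)//.
by move/eqP.
Qed.

Lemma prim_root_conj n w k : n.-primitive_root w -> (w ^+ k)^* = (w ^+ k)^-1.
Proof.
move=> wn; set x := w ^+ _.
have x1 : normc x = 1 by rewrite normcX (prim_root_normc wn) expr1n.
have x0 : x != 0 by rewrite -normc_gt0 x1.
by apply: (mulfI x0); rewrite divff// -normc_sqrE x1 expr1n.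
Qed.

Lemma prim_root_orthogonal N w (k l : nat) : N.-primitive_root w ->
  (k < N)%N -> (l < N)%N ->
  \sum_(j < N) (w ^+ j) ^+ k * ((w ^+ j) ^+ l)^-1 = (N * (k == l))%:R.
Proof.
move=> wN kN lN; have w0 : w != 0 by rewrite -normc_gt0 (prim_root_normc wN).
have E j : (w ^+ j) ^+ k * ((w ^+ j) ^+ l)^-1 = (w ^+ k / w ^+ l) ^+ j.
  by rewrite exprMn exprVn -!exprM ![(j * _)%N]mulnC !exprM.
under eq_bigr do rewrite E.
have [->|kl] := eqVneq k l.
  rewrite muln1 divff ?expf_neq0//; under eq_bigr do rewrite expr1n.
  by rewrite sumr_const card_ord.
rewrite muln0; set x := _ / _.
have x1 : x - 1 != 0.
  rewrite subr_eq0; apply: contra kl => /eqP xE.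
  have := eq_prim_root_expr wN k l; rewrite !modn_small// => <-.
  by rewrite -[w ^+ k](divfK (expf_neq0 l w0)) -/x xE mul1r.
apply: (mulfI x1); rewrite mulr0 -subrX1 /x exprMn exprVn -!exprM.
by rewrite ![(_ * N)%N]mulnC !exprM (prim_expr_order wN) !expr1n divr1 subrr.
Qed.

Lemma parseval_roots N w (t : 'I_N -> R[i]) : N.-primitive_root w ->
  \sum_(j < N) normc (\sum_(n < N) t n * (w ^+ j) ^+ n) ^+ 2
  = N%:R * \sum_(n < N) normc (t n) ^+ 2.
Proof.
move=> wN; apply: (@complexI R).
have conjw (j n : nat) : ((w ^+ j) ^+ n)^* = ((w ^+ j) ^+ n)^-1.
  by rewrite -exprM (prim_root_conj _ wN).
rewrite rmorph_sum rmorphM rmorph_sum rmorph_nat mulr_sumr/=.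
under eq_bigr => j _.
  rewrite normc_sqrE rmorph_sum mulr_suml.
  under eq_bigr => n _ do rewrite mulr_sumr.
  over.
rewrite exchange_big/=; apply: eq_bigr => n _; rewrite exchange_big/=.
rewrite (bigD1 n)//= [X in _ + X]big1 ?addr0 => [|m mn].
  under eq_bigr do rewrite rmorphM /= conjw mulrACA.
  by rewrite -mulr_sumr prim_root_orthogonal// eqxx muln1 -normc_sqrE mulrC.
under eq_bigr do rewrite rmorphM /= conjw mulrACA.
rewrite -mulr_sumr prim_root_orthogonal//.
have -> : (n == m :> nat) = false by apply/negbTE; rewrite eq_sym.
by rewrite muln0 mulr0.
Qed.

Lemma bernoulli_ge (x : R) n : 0 <= x <= 1 -> 1 - n%:R * x <= (1 - x) ^+ n.
Proof.
move=> /andP[x0 x1]; elim: n => [|n IH]; first by rewrite mul0r subr0.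
rewrite exprS (@le_trans _ _ ((1 - x) * (1 - n%:R * x)))//; last first.
  by rewrite ler_wpM2l// subr_ge0.
have n0 : 0 <= n%:R * (x * x) by rewrite !mulr_ge0.
rewrite -natr1; lra.
Qed.

(* Multiplication by a Schur function contracts coefficients.  Averaging
   <y, f(z w^j)> over the N-th roots of unity w^j isolates the sum of the
   |y_n|^2 as the value at 0 of a smooth function G, and the maximum principle
   bounds it by the discrete Parseval identity on |z| = r, r -> 1. *)
Lemma coef_contraction m (f : 'I_m -> R[i] -> R[i]) (y : 'I_m -> nat -> R[i])
    (v : nat -> R[i]) (N : nat) :
  (forall i, exists2 rho, smooth rho &
     forall z, normc z < 1 -> f i z = psum (y i) z N + z ^+ N * rho z) ->
  (forall z, normc z < 1 ->
     \sum_i normc (f i z) ^+ 2 <= normc (psum v z N) ^+ 2) ->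
  \sum_i \sum_(n < N) normc (y i n) ^+ 2 <= \sum_(n < N) normc (v n) ^+ 2.
Proof.
move=> fT fv.
have /choice[rho rhoP] : forall i, exists rho, smooth rho /\
    forall z, normc z < 1 -> f i z = psum (y i) z N + z ^+ N * rho z.
  by move=> i; have [rho ? ?] := fT i; exists rho.
have srho i := (rhoP i).1; have frho i := (rhoP i).2.
have [->|N0] := posnP N; first by rewrite big_ord0 big1// => i _;
  rewrite big_ord0.
have [w wN] := prim_root_exists N0; have nw := prim_root_normc wN.
have nwj (j : nat) : normc (w ^+ j) = 1 by rewrite normcX nw expr1n.
have w0 (j : nat) : w ^+ j != 0 by rewrite -normc_gt0 nwj.
set Y := \sum_i _; set V := \sum_(n < N) _.
(* For nonzero z this is the sum over j of the pairings with f (z w^j), see [GE]. Writing z^(N - n)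
   for z^N / z^n makes it smooth at 0 too, where the second part vanishes because n < N. *)
pose G z : R[i] := (N%:R * Y)%:C%C + \sum_i \sum_(n < N) ((y i n)^* *
  \sum_(j < N) (((w ^+ j) ^+ n)^-1 * z ^+ (N - n) * rho i (z * w ^+ j))).
have sG : smooth G.
  apply: smoothD; first exact: smooth_cst.
  apply: smooth_sum => i; apply: smooth_sum => n.
  apply: smoothM; first exact: smooth_cst.
  apply: smooth_sum => j; apply: smoothM; last exact: smooth_rot.
  by apply: smoothM; [exact: smooth_cst|exact/smooth_exp/smooth_id].
have G0 : G 0 = (N%:R * Y)%:C%C.
  rewrite /G big1 ?addr0// => i _; rewrite big1// => n _.
  rewrite big1 ?mulr0// => j _.
  by rewrite expr0n subn_eq0 leqNgt ltn_ord mulr0 mul0r.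
have GE z : z != 0 -> normc z < 1 -> G z = \sum_(j < N) \sum_i
    (\sum_(n < N) ((y i n)^* / z ^+ n) / (w ^+ j) ^+ n) * f i (z * w ^+ j).
  move=> z0 z1; rewrite exchange_big/= /G mulr_sumr rmorph_sum -big_split/=.
  apply: eq_bigr => i _.
  have wjN (j : nat) : (w ^+ j) ^+ N = 1.
    by rewrite -exprM mulnC exprM (prim_expr_order wN) expr1n.
  pose a (n : 'I_N) := (y i n)^* / z ^+ n.
  have -> : \sum_(j < N) (\sum_(n < N) a n / (w ^+ j) ^+ n) * f i (z * w ^+ j)
    = \sum_(j < N) (\sum_(n < N) a n / (w ^+ j) ^+ n) * psum (y i) (z * w ^+ j)
      N
    + \sum_(j < N) \sum_(n < N) a n / (w ^+ j) ^+ n * (z ^+ N * rho i (z * w ^+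
      j)).
    rewrite -big_split; apply: eq_bigr => j _ /=.
    by rewrite frho ?normcM ?nwj ?mulr1//
      mulrDr exprMn wjN mulr1 [X in _ + X]mulr_suml.
  congr (_ + _).
    rewrite rmorphM rmorph_sum rmorph_nat mulr_sumr /psum.
    under [RHS]eq_bigr => j _.
      rewrite mulr_suml.
      under eq_bigr => n _ do rewrite mulr_sumr.
      over.
    rewrite [RHS]exchange_big/=; apply: eq_bigr => n _; rewrite exchange_big/=.
    rewrite (bigD1 n)//= [X in _ = _ + X]big1 ?addr0 => [|k kn].
      rewrite (eq_bigr (fun j : 'I_N => y i n * (y i n)^*)) => [|j _].
        by rewrite sumr_const card_ord -normc_sqrE mulr_natl.
      rewrite /a exprMn; field.
      by rewrite (expf_neq0 _ (w0 j)) (expf_neq0 _ z0).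
    rewrite (eq_bigr (fun j : 'I_N => a n * y i k * z ^+ k *
        ((w ^+ j) ^+ k * ((w ^+ j) ^+ n)^-1))) => [|j _].
      rewrite -mulr_sumr prim_root_orthogonal//.
      have -> : (k == n :> nat) = false by apply/negbTE.
      by rewrite muln0 mulr0.
    by rewrite exprMn; ring.
  rewrite exchange_big/=; apply: eq_bigr => n _; rewrite mulr_sumr.
  apply: eq_bigr => j _; rewrite /a.
  have -> : z ^+ N = z ^+ (N - n) * z ^+ n by rewrite -exprD subnK// ltnW.
  field.
  by rewrite (expf_neq0 _ (w0 j)) (expf_neq0 _ z0).
(* By p q <= (p^2 + q^2) / 2 and discrete Parseval, the factors built from y contribute at most N Y
   / r^(2N), and f contributes at most N V. *)
have Gb (r : R) : 0 < r < 1 -> forall z, normc z = r ->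
    normc (G z) <= N%:R * (Y / r ^+ (2 * N) + V) / 2.
  move=> /andP[r0 r1] z zr; have z0 : z != 0 by rewrite -normc_gt0 zr.
  rewrite GE ?zr// (le_trans (ler_normc_sum _ _ _))//.
  pose A (j : 'I_N) i := \sum_(n < N) ((y i n)^* / z ^+ n) / (w ^+ j) ^+ n.
  apply: (@le_trans _ _ (\sum_(j < N) \sum_i
      (normc (A j i) ^+ 2 + normc (f i (z * w ^+ j)) ^+ 2) / 2)).
    apply: ler_sum => j _; rewrite (le_trans (ler_normc_sum _ _ _))//.
    apply: ler_sum => i _; rewrite normcM -/(A j i).
    have := sqr_ge0 (normc (A j i) - normc (f i (z * w ^+ j))).
    rewrite sqrrB; lra.
  under eq_bigr do rewrite -mulr_suml big_split/=.
  rewrite -mulr_suml ler_wpM2r ?invr_ge0// big_split/= mulrDr lerD//.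
    rewrite exchange_big/= /Y mulr_suml mulr_sumr; apply: ler_sum => i _.
    rewrite (eq_bigr (fun j : 'I_N =>
        normc (\sum_(n < N) (y i n / (z ^+ n)^*) * (w ^+ j) ^+ n) ^+ 2)) =>
          [|j _].
      rewrite parseval_roots// ler_wpM2l// mulr_suml; apply: ler_sum => n _.
      rewrite normcM normcV normcJE normcX zr exprMn ler_wpM2l ?sqr_ge0//.
      rewrite exprVn lef_pV2 ?posrE ?exprn_gt0// -exprM mulnC.
      by rewrite ler_wiXn2l ?(ltW r0) ?(ltW r1)// leq_mul2r ltnW ?orbT.
    congr (_ ^+ 2); rewrite -normcJE rmorph_sum; congr normc.
    apply: eq_bigr => n _; rewrite !rmorphM !fmorphV /= conjCK -exprM.
    by rewrite (prim_root_conj _ wN) invrK.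
  apply: (@le_trans _ _ (\sum_(j < N) normc (psum v (z * w ^+ j) N) ^+ 2)).
    by apply: ler_sum => j _; apply: fv; rewrite normcM zr nwj mulr1.
  rewrite (eq_bigr (fun j : 'I_N =>
        normc (\sum_(n < N) (v n * z ^+ n) * (w ^+ j) ^+ n) ^+ 2)) => [|j _].
    rewrite parseval_roots// ler_wpM2l//; apply: ler_sum => n _.
    rewrite normcM normcX zr exprMn ler_piMr ?sqr_ge0//.
    by rewrite -exprM exprn_ile1 ?(ltW r0) ?(ltW r1).
  by congr (normc _ ^+ 2); apply: eq_bigr => n _; rewrite exprMn mulrA.
have Y0 : 0 <= Y by apply: sumr_ge0 => i _; apply: sumr_ge0 => n _;
  exact: sqr_ge0.
have V0 : 0 <= V by apply: sumr_ge0 => n _; exact: sqr_ge0.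
have YV (r : R) : 0 < r < 1 -> 2 * (Y * r ^+ (2 * N)) <= Y + V.
  move=> r01; have /andP[r0 r1] := r01.
  have := maximum_principle r01 (sG 3) (Gb r r01) (_ : normc 0 <= r).
  rewrite normc0 ltW// G0 normc_real ger0_norm ?mulr_ge0// => /(_ isT).
  rewrite -mulrA ler_pM2l ?ltr0n// ler_pdivlMr//.
  set s := r ^+ _ => h; have s0 : 0 < s by rewrite exprn_gt0.
  have s1 : s <= 1 by rewrite exprn_ile1 ?(ltW r0) ?(ltW r1).
  have := ler_wpM2r (ltW s0) h; rewrite mulrDl divfK ?gt_eqF// => h'.
  rewrite mulrA [2 * Y]mulrC (le_trans h')// lerD2l.
  by rewrite ler_piMr.
apply/ler_addgt0Pr => e e0.
(* With r = 1 - x, Bernoulli's inequality gives r^(2N) >= 1 - 2 N x; x is small enough for the loss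
   2 N x * 2 Y to be at most e. *)
pose x := Num.min 2^-1 (e / ((2 * N)%:R * (2 * Y + 1))).
have N2 : 0 < (2 * N)%:R * (2 * Y + 1) :> R.
  by rewrite mulr_gt0 ?ltr0n ?muln_gt0// ltr_wpDl// mulr_ge0.
have x0 : 0 < x by rewrite lt_min invr_gt0 ltr0n divr_gt0.
have x1 : x < 1 by rewrite gt_min invf_lt1// ltr1n.
have xe : (2 * N)%:R * x * (2 * Y) <= e.
  apply: (@le_trans _ _ (x * ((2 * N)%:R * (2 * Y + 1)))).
    by have := mulr_ge0 (ltW x0) (ler0n R (2 * N)); lra.
  by rewrite -ler_pdivlMr// ge_min lexx orbT.
have := YV (1 - x); rewrite subr_gt0 x1 gtrBl x0 => /(_ isT).
have := @bernoulli_ge x (2 * N); rewrite (ltW x0) (ltW x1) => /(_ isT) bx h.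
have := ler_wpM2l Y0 bx; move: ((1 - x) ^+ _) h xe => s; move: (_%:R * x) => k.
nra.
Qed.

(** Comparing f with the constant 1 in [coef_contraction] bounds its Taylor coefficients by 1, after
    which [taylor_ev] applies. *)
Lemma smooth_bounded_ev f : smooth f ->
  (forall z, normc z < 1 -> normc (f z) <= 1) ->
  exists2 c, cbounded 1 c & forall z, normc z < 1 -> f z = ev c z.
Proof.
move=> sf f1; have [c fc] := smooth_taylor sf.
have cB : cbounded 1 c.
  move=> n; pose v (k : nat) : R[i] := (k == 0%N)%:R.
  have := @coef_contraction 1 (fun=> f) (fun=> c) v n.+1.
  rewrite big_ord1 => cc.
  have /cc{cc} h : forall i : 'I_1, exists2 rho, smooth rho &
      forall z, normc z < 1 -> f z = psum c z n.+1 + z ^+ n.+1 * rho z.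
    by move=> _; have [rho srho frho] := fc n.+1; exists rho.
  have : forall z, normc z < 1 ->
      \sum_(i < 1) normc (f z) ^+ 2 <= normc (psum v z n.+1) ^+ 2.
    move=> z z1; rewrite big_ord1 psumS /psum big1 ?mulr0 => [|k _].
      by rewrite addr0 normc1 expr1n expr_le1 ?normc_ge0 ?f1.
    by rewrite mul0r.
  have vE : \sum_(k < n.+1) normc (v k) ^+ 2 = 1.
    rewrite big_ord_recl normc1 expr1n big1 ?addr0// => k _.
    by rewrite normc0 expr0n.
  move=> /h; rewrite vE big_ord_recr/= => h1.
  rewrite -(@expr_le1 _ 2) ?normc_ge0// (le_trans _ h1)// lerDr.
  by apply: sumr_ge0 => k _; exact: sqr_ge0.
exists c => //; apply: (taylor_ev cB fc) => r /andP[_ r1]; exists 1 => z zr.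
by rewrite f1// zr.
Qed.

End CoefficientContraction.

(** * Blaschke factors on square summable sequences *)

Section SquareSummable.
Context {R : realType}.
Implicit Types (c d f g h u : nat -> R[i]) (z w a : R[i]) (t : R).

(** The bound is on the squared norm, through partial sums, so that no limit is involved in stating
    it. *)
Definition l2le t c := forall N, \sum_(n < N) normc (c n) ^+ 2 <= t.

Lemma l2le_ge0 t c : l2le t c -> 0 <= t.
Proof. by move=> /(_ 0%N); rewrite big_ord0. Qed.

Lemma l2le_le t t' c : t <= t' -> l2le t c -> l2le t' c.
Proof. by move=> tt ct N; exact: le_trans (ct N) tt. Qed.

Lemma l2le_bounded t c : l2le t c -> cbounded (Num.sqrt t) c.
Proof.
move=> ct n; rewrite -[normc _]ger0_norm ?normc_ge0// -sqrtr_sqr ler_wsqrtr//.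
rewrite (le_trans _ (ct n.+1))// big_ord_recr/= lerDr.
by apply: sumr_ge0 => i _; exact: sqr_ge0.
Qed.

Lemma bounded_sum_cauchy (v : nat -> R) t : (forall k, 0 <= v k) ->
  (forall N, \sum_(k < N) v k <= t) -> forall e : R, 0 < e ->
  exists K, forall m n, (K <= m)%N -> (m <= n)%N ->
    \sum_(k < n) v k - \sum_(k < m) v k < e.
Proof.
move=> v0 vt e e0; pose s n := \sum_(k < n) v k.
have s_nd : nondecreasing_seq s.
  by apply/nondecreasing_seqP => n; rewrite /s big_ord_recr/= lerDl.
have s_ub : has_ubound (range s) by exists t => _ [n _ <-]; exact: vt.
have /cvgrPdist_lt := nondecreasing_cvgn s_nd s_ub.
move=> /(_ _ e0)[K _ Ks]; exists K => m n Km mn.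
have := Ks m Km => /=; rewrite ltr_norml => /andP[_].
apply: le_lt_trans; rewrite -/(s n) -/(s m) lerB// ub_le_sup//.
Qed.

Lemma l2le_small t c (e : R) : l2le t c -> 0 < e ->
  exists K, forall n, (K <= n)%N -> normc (c n) < e.
Proof.
move=> ct e0.
have [||K Kc] := @bounded_sum_cauchy
  (fun n => normc (c n) ^+ 2) t _ ct (e ^+ 2).
- by move=> k; exact: sqr_ge0.
- by rewrite exprn_gt0.
exists K => n Kn; have := Kc n n.+1 Kn (leqnSn n).
by rewrite big_ord_recr/= addrAC subrr add0r ltr_pXn2r ?nnegrE ?normc_ge0 ?ltW.
Qed.

(** Partial sums increase, so an error term s N only has to be small at late indices. *)
Lemma l2le_lim t c (s : nat -> R) (l : R) :
  (forall N, \sum_(n < N) normc (c n) ^+ 2 <= t + s N) ->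
  (forall e : R, 0 < e -> exists K, forall n, (K <= n)%N -> s n < l + e) ->
  l2le (t + l) c.
Proof.
move=> cs sl N; apply/ler_addgt0Pr => e /sl[K Ks].
apply: (@le_trans _ _ (\sum_(n < K + N) normc (c n) ^+ 2)).
  rewrite addnC big_split_ord/= lerDl.
  by apply: sumr_ge0 => i _; exact: sqr_ge0.
by rewrite (le_trans (cs _))// -addrA lerD2l ltW// Ks// leq_addr.
Qed.

End SquareSummable.

(** * Multiplication and division by Blaschke factors *)

Section Blaschke.
Context {R : realType}.
Implicit Types (c d f g h u : nat -> R[i]) (z w a : R[i]) (t : R).

Definition blaschke a z : R[i] := (z - a) / (1 - z * a^*).

Lemma normc_lt1_neq0 z : normc z < 1 -> 1 - z != 0.
Proof.
by move=> z1; rewrite subr_eq0; apply: contraTneq z1 => <-; rewrite normc1 ltxx.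
Qed.

Lemma blaschke_den a z : normc a < 1 -> normc z < 1 -> 1 - z * a^* != 0.
Proof.
move=> a1 z1; apply: normc_lt1_neq0; rewrite normcM normcJE.
by rewrite mulr_ilt1 ?normc_ge0.
Qed.

Lemma blaschke_lt1 a z : normc a < 1 -> normc z < 1 -> normc (blaschke a z) < 1.
Proof.
move=> a1 z1; have d0 := blaschke_den a1 z1.
rewrite normcM normcV ltr_pdivrMr ?normc_gt0// mul1r.
rewrite -(@ltr_pXn2r _ 2) ?nnegrE ?normc_ge0// -subr_gt0.
have -> : normc (1 - z * a^*) ^+ 2 - normc (z - a) ^+ 2
    = (1 - normc a ^+ 2) * (1 - normc z ^+ 2).
  rewrite mulrBl mul1r mulrBr mulr1 -exprMn -normcM.
  apply: (@complexI R); rewrite !rmorphB rmorph1 /= !normc_sqrE.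
  rewrite !rmorphB !rmorphM !rmorph1 /= conjCK; ring.
by rewrite mulr_gt0// subr_gt0 expr_lt1// normc_ge0.
Qed.

(* If U is the power series of u, the coefficients of (z - a) U and of
   (1 - a^* z) U.  These two products have the same modulus on the circle. *)
Definition bnum a u n := (if n is m.+1 then u m else 0) - a * u n.
Definition bden a u n := u n - a^* * (if n is m.+1 then u m else 0).

(** Truncation leaves a single boundary term. It is nonnegative for |a| <= 1, which is enough for
    [blaschke_mul]; [blaschke_div] has to show that it is small. *)
Lemma bnum_bden a u N :
  \sum_(n < N.+1) normc (bden a u n) ^+ 2 =
  \sum_(n < N.+1) normc (bnum a u n) ^+ 2 + (1 - normc a ^+ 2) * normc (u N) ^+
    2.
Proof.
have E x y : normc (x - a^* * y) ^+ 2 + (1 - normc a ^+ 2) * normc y ^+ 2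
    = normc (y - a * x) ^+ 2 + (1 - normc a ^+ 2) * normc x ^+ 2.
  rewrite !mulrBl !mul1r -!exprMn -!normcM.
  apply: (@complexI R); rewrite !(rmorphD, rmorphN) /= !normc_sqrE.
  rewrite !rmorphB !rmorphM /= conjCK; ring.
elim: N => [|N IH].
  by have := E (u 0%N) 0; rewrite !big_ord1 normc0 expr0n /= (mulr0 (1 - _))
    addr0.
rewrite big_ord_recr/= IH [in RHS]big_ord_recr/= -!addrA; congr (_ + _).
by rewrite addrC E.
Qed.

Lemma ev_bnum B a u z : cbounded B u -> normc z < 1 ->
  ev (bnum a u) z = (z - a) * ev u z.
Proof.
move=> uB z1; pose s n := if n is m.+1 then u m else 0.
have sB : cbounded B s.
  by case=> [|n]; [rewrite normc0 (cbounded_ge0 uB)|exact: uB].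
have auB : cbounded (normc a * B) (fun n => a * u n).
  by move=> n; rewrite normcM ler_wpM2l ?normc_ge0.
by rewrite (evB sB auB z1) (ev_shift sB z1) add0r (evZ a uB z1) mulrBl.
Qed.

Lemma ev_bden B a u z : cbounded B u -> normc z < 1 ->
  ev (bden a u) z = (1 - z * a^*) * ev u z.
Proof.
move=> uB z1; pose s n := if n is m.+1 then u m else 0.
have sB : cbounded B s.
  by case=> [|n]; [rewrite normc0 (cbounded_ge0 uB)|exact: uB].
have asB : cbounded (normc a^* * B) (fun n => a^* * s n).
  by move=> n; rewrite normcM ler_wpM2l ?normc_ge0.
rewrite (evB uB asB z1) (evZ _ sB z1) (ev_shift sB z1) add0r; ring.
Qed.

Lemma blaschke_mul a t g : normc a < 1 -> l2le t g ->
  exists2 h, l2le t h &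
    forall z, normc z < 1 -> ev h z = blaschke a z * ev g z.
Proof.
move=> a1 gt; have gB := l2le_bounded gt;
  have a1' : 0 < 1 - normc a by rewrite subr_gt0.
(* The coefficients of g / (1 - a^* z). *)
pose u := fix u n := g n + (if n is m.+1 then a^* * u m else 0).
have ug : bden a u = g.
  apply/funext => -[|n]; rewrite /bden /=; first by rewrite mulr0 subr0 addr0.
  by rewrite addrK.
have uB : cbounded (Num.sqrt t / (1 - normc a)) u.
  have q0 : 0 <= Num.sqrt t / (1 - normc a) by rewrite divr_ge0 ?sqrtr_ge0 ?ltW.
  elim=> [|n IH] /=; rewrite (le_trans (ler_normcD _ _))//.
    rewrite normc0 addr0 (le_trans (gB _))// ler_pdivlMr//
      ler_piMr ?sqrtr_ge0//.
    by rewrite gerBl normc_ge0.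
  rewrite normcM normcJE.
  apply: (@le_trans _ _ (Num.sqrt t + normc a * (Num.sqrt t / (1 - normc a)))).
    by rewrite lerD// ler_wpM2l ?normc_ge0.
  rewrite le_eqVlt; apply/orP; left; apply/eqP; field.
  by rewrite gt_eqF.
exists (bnum a u).
  case=> [|N]; first by rewrite big_ord0 (l2le_ge0 gt).
  rewrite (le_trans _ (gt N.+1))// -ug bnum_bden lerDl.
  by rewrite mulr_ge0 ?sqr_ge0// subr_ge0 expr_le1 ?normc_ge0 ?ltW.
move=> z z1; rewrite (ev_bnum _ uB z1) -[in RHS]ug (ev_bden _ uB z1) /blaschke.
by rewrite mulrA divfK// blaschke_den.
Qed.

Lemma blaschke_div a t h : normc a < 1 -> l2le t h -> ev h a = 0 ->
  exists2 g, l2le t g &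
    forall z, normc z < 1 -> ev h z = blaschke a z * ev g z.
Proof.
move=> a1 ht ha0; have hB := l2le_bounded ht;
  have a1' : 0 < 1 - normc a by rewrite subr_gt0.
(* The coefficients of h / (z - a), as h vanishes at a. *)
pose u := quot h a; have uB : cbounded _ u := quot_bounded hB a1.
have uh : bnum a u = h.
  apply/funext => -[|n]; rewrite /bnum /u.
    have := quot_rec0 hB a1; rewrite ha0 => /eqP;
      rewrite eq_sym addr_eq0 => /eqP ->.
    by rewrite sub0r.
  by rewrite (quot_rec n hB a1) addrK.
exists (bden a u); last first.
  move=> z z1; rewrite -{1}uh (ev_bnum _ uB z1) (ev_bden _ uB z1) /blaschke.
  by rewrite mulrA divfK// blaschke_den.
case=> [|N]; first by rewrite big_ord0 (l2le_ge0 ht).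
suff : l2le (t + 0) (bden a u) by move=> /(_ N.+1); rewrite addr0.
apply: (@l2le_lim _ _ _ (fun N => if N is m.+1 then normc (u m) ^+ 2 else 0)).
  case=> [|m]; first by rewrite big_ord0 addr0 (l2le_ge0 ht).
  rewrite bnum_bden uh lerD ?ht// ler_piMl ?sqr_ge0// gerBl sqr_ge0.
  by [].
(* The boundary term tends to 0: u n is the value at a of a series whose coefficients are the late,
   hence small, coefficients of h. *)
move=> e e0; have se0 : 0 < Num.sqrt e by rewrite sqrtr_gt0.
have e1 : 0 < Num.sqrt e * (1 - normc a) / 2 by rewrite divr_gt0// mulr_gt0.
have [K Kh] := l2le_small ht e1; exists K.+1 => -[//|n] Kn.
rewrite add0r -[X in _ < X](@sqr_sqrtr _ e) ?ltW//
  ltr_pXn2r ?nnegrE ?normc_ge0 ?ltW//.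
have hK : cbounded (Num.sqrt e * (1 - normc a) / 2) (fun k => h (n.+1 + k)%N).
  by move=> k; apply/ltW/Kh; rewrite (leq_trans _ (leq_addr _ _))// ltnW.
rewrite (le_lt_trans (ev_bound hK a1))// mulrAC mulfK ?gt_eqF//.
by rewrite ltr_pdivrMr// mulr_natr mulr2n ltrDl.
Qed.

Section Products.
Context {I : eqType} (a : I -> R[i]).
Context (a1 : forall i, normc (a i) < 1).

Lemma blaschke_prod_mul (s : seq I) t g : l2le t g ->
  exists2 h, l2le t h & forall z, normc z < 1 ->
    ev h z = \prod_(i <- s) blaschke (a i) z * ev g z.
Proof.
move=> gt; elim: s => [|i s [h ht hE]].
  by exists g => // z _; rewrite big_nil mul1r.
have [k kt kE] := blaschke_mul (a1 i) ht; exists k => // z z1.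
by rewrite kE// hE// big_cons mulrA.
Qed.

(** As the points are distinct, a factor is nonzero at the zeros still to be divided out, so they
    remain zeros of the quotient. *)
Lemma blaschke_prod_div (s : seq I) t h : injective a -> uniq s -> l2le t h ->
  (forall i, i \in s -> ev h (a i) = 0) ->
  exists2 g, l2le t g & forall z, normc z < 1 ->
    ev h z = \prod_(i <- s) blaschke (a i) z * ev g z.
Proof.
move=> aI; elim: s h => [|i s IH] h /=.
  by move=> _ ht _; exists h => // z _; rewrite big_nil mul1r.
move=> /andP[si us] ht h0.
have [|g gt gE] := blaschke_div (a1 i) ht; first by rewrite h0// mem_head.
have [|k kt kE] := IH g us gt.
  move=> j js; have := h0 j; rewrite inE js orbT => /(_ isT) /eqP.
  rewrite gE// mulf_eq0 => /orP[|/eqP//]; rewrite mulf_eq0 subr_eq0 invr_eq0.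
  rewrite (negbTE (blaschke_den (a1 i) (a1 j))) orbF => /eqP/aI ji.
  by move: si; rewrite -ji js.
by exists k => // z z1; rewrite gE// kE// big_cons mulrA.
Qed.

End Products.
End Blaschke.

(** * Positive definite square roots *)

Section PositiveSquareRoot.
Local Open Scope sesquilinear_scope.
Context {R : realType}.

Lemma trmxC_mul m n p (A : 'M[R[i]]_(m, n)) (B : 'M[R[i]]_(n, p)) :
  (A *m B) ^t* = B ^t* *m A ^t*.
Proof. by rewrite trmx_mul map_mxM. Qed.

Lemma hermsymmxE n (A : 'M[R[i]]_n) : (A \is hermsymmx) = (A == A ^t*).
Proof. by rewrite is_hermitianmxE expr0 scale1r. Qed.

Lemma quad_diag n (d : 'rV[R[i]]_n) (y : 'cV[R[i]]_n) :
  (y ^t* *m diag_mx d *m y) 0 0 = \sum_i d 0 i * (y i 0 * (y i 0)^*).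
Proof.
rewrite mul_mx_diag !mxE; apply: eq_bigr => i _; rewrite !mxE; ring.
Qed.

Lemma posdef_diag n (U : 'M[R[i]]_n) (d : 'rV[R[i]]_n) : U \is unitarymx ->
  (forall i, 0 < d 0 i) -> posdefmx (U ^t* *m diag_mx d *m U).
Proof.
move=> uU d0; split.
  have dE : (diag_mx d) ^t* = diag_mx d.
    rewrite tr_diag_mx map_diag_mx; congr diag_mx; apply/rowP => i.
    by rewrite mxE; apply/CrealP; rewrite gtr0_real.
  by rewrite hermsymmxE !trmxC_mul trmxCK dE mulmxA.
move=> x x0; rewrite !mulmxA -trmxC_mul -mulmxA quad_diag.
have [i yi] : exists i, (U *m x) i 0 != 0.
  apply/existsP; rewrite -[[exists _, _]]negbK negb_exists;
    apply/negP => /forallP y0.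
  move/negP: x0; apply; rewrite -[x](mulKmx (unitarymx_unit uU)).
  have -> : U *m x = 0.
    by apply/matrixP => i j; rewrite ord1 [RHS]mxE; apply/eqP;
      rewrite -[_ == _]negbK y0.
  by rewrite mulmx0.
have nn j : 0 <= (U *m x) j 0 * ((U *m x) j 0)^* by rewrite -normCK exprn_ge0.
rewrite (bigD1 i)//= ltr_pwDl//.
  by rewrite mulr_gt0// lt_neqAle nn andbT eq_sym mulf_neq0// conjC_eq0.
by apply: sumr_ge0 => j _; rewrite mulr_ge0// ltW.
Qed.

Lemma posdef_sqrt_exists n (P : 'M[R[i]]_n) : posdefmx P ->
  exists2 Q, posdefmx Q & Q *m Q = P.
Proof.
move=> [hP pP]; have := hermitian_normalmx hP => /orthomx_spectralP PE.
set U := spectralmx P in PE; set d := spectral_diag P in PE.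
have uU : U \is unitarymx := spectral_unitarymx P.
have UU : U *m U ^t* = 1%:M by apply/unitarymxP.
rewrite (invmx_unitary uU) in PE.
(* An eigenvalue is the value of the quadratic form at the unit eigenvector U^* e_i. *)
have d0 i : 0 < d 0 i.
  pose e : 'cV[R[i]]_n := delta_mx i 0.
  have -> : d 0 i = ((U ^t* *m e) ^t* *m P *m (U ^t* *m e)) 0 0.
    rewrite {1}PE trmxC_mul trmxCK !mulmxA -[_ *m U *m U ^t*]mulmxA UU mulmx1.
    rewrite -[_ *m U *m U ^t*]mulmxA UU mulmx1 quad_diag (bigD1 i)//= big1
      ?addr0.
      by rewrite !mxE !eqxx /= conjC1 !mulr1.
    by move=> j ji; rewrite !mxE (negbTE ji) mul0r mulr0.
  apply: pP; apply/eqP => /(congr1 (mulmx U)); rewrite mulmxA UU mul1mx mulmx0.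
  by move=> /matrixP/(_ i 0)/eqP; rewrite !mxE !eqxx oner_eq0.
pose s : 'rV[R[i]]_n := \row_i sqrtC (d 0 i).
exists (U ^t* *m diag_mx s *m U).
  by apply: posdef_diag => // i; rewrite mxE sqrtC_gt0.
rewrite [in RHS]PE !mulmxA -[_ *m U *m U ^t*]mulmxA UU mulmx1.
congr (_ *m U); rewrite -mulmxA; congr (_ *m _); rewrite mulmx_diag.
by congr diag_mx; apply/rowP => i; rewrite !mxE -expr2 sqrtCK.
Qed.

Lemma posdef_sqrtmxP n (P : 'M[R[i]]_n) : posdefmx P ->
  posdefmx (posdef_sqrtmx P) /\ posdef_sqrtmx P *m posdef_sqrtmx P = P.
Proof.
move=> /posdef_sqrt_exists[Q pQ QQ]; rewrite /posdef_sqrtmx.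
by case: xgetP => [S _ []//|/(_ Q)[]].
Qed.

Lemma posdef_unitmx n (Q : 'M[R[i]]_n) : posdefmx Q -> Q \in unitmx.
Proof.
move=> [hQ pQ]; rewrite -unitmx_tr -row_free_unit -kermx_eq0.
apply/negP => /negP/matrix0Pn[i [j ij]].
pose x : 'cV[R[i]]_n := (row i (kermx Q^T))^T.
have Qx : Q *m x = 0.
  apply: trmx_inj; rewrite trmx_mul trmxK trmx0; apply/sub_kermxP.
  exact: row_sub.
have : 0 < (x ^t* *m Q *m x) 0 0.
  apply: pQ; apply: contraNneq ij => x0.
  have : x j 0 = 0 by rewrite x0 mxE.
  by rewrite /x 2!mxE => ->.
by rewrite -mulmxA Qx mulmx0 mxE ltxx.
Qed.

End PositiveSquareRoot.

(** * Szego kernels *)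

Section Kernels.
Local Open Scope sesquilinear_scope.
Context {R : realType} {M : nat}.
Context (a : 'I_M -> R[i]).
Context (a1 : forall l, normc (a l) < 1).
Implicit Types (c x : 'cV[R[i]]_M) (f : nat -> R[i]) (z : R[i]) (t B : R).

Definition szego_gram : 'M[R[i]]_M := \matrix_(l, j) (1 - a l * (a j)^*)^-1.

Definition szego_comb c z : R[i] := \sum_j c j 0 / (1 - z * (a j)^*).

(** The power series coefficients of [szego_comb c], see [ev_kcoef]. *)
Definition kcoef c n : R[i] := \sum_j c j 0 * (a j)^* ^+ n.

Lemma kcoef_bounded c : cbounded (\sum_j normc (c j 0)) (kcoef c).
Proof.
move=> n; rewrite (le_trans (ler_normc_sum _ _ _))//; apply: ler_sum => j _.
rewrite normcM normcX normcJE ler_piMr ?normc_ge0// exprn_ile1 ?normc_ge0//.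
exact: ltW.
Qed.

Lemma ev_geometric w z : normc w < 1 -> normc z < 1 ->
  ev (fun n => w ^+ n) z = (1 - z * w)^-1.
Proof.
move=> w1 z1; have wB : cbounded 1 (fun n => w ^+ n).
  by move=> n; rewrite normcX exprn_ile1 ?normc_ge0// ltW.
have d0 : 1 - z * w != 0.
  by apply: normc_lt1_neq0; rewrite normcM mulr_ilt1 ?normc_ge0.
have E : ev (fun n => w ^+ n.+1) z = w * ev (fun n => w ^+ n) z.
  by rewrite -(evZ _ wB z1); congr ev; apply/funext => n; rewrite exprS.
have := ev_shift wB z1; rewrite E expr0 => h.
apply: (mulIf d0); rewrite mulVf//; move: h; move: (ev _ _) => X h.
by rewrite mulrBr {1}h; ring.
Qed.

Lemma ev_kcoef c z : normc z < 1 -> ev (kcoef c) z = szego_comb c z.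
Proof.
move=> z1.
have gB j : cbounded 1 (fun n => (a j)^* ^+ n).
  by move=> n; rewrite normcX normcJE exprn_ile1 ?normc_ge0// ltW.
have cB j : cbounded (\sum_j normc (c j 0)) (fun n => c j 0 * (a j)^* ^+ n).
  move=> n; rewrite normcM (bigD1 j)//= ler_wpDr//.
    by apply: sumr_ge0 => i _; exact: normc_ge0.
  by rewrite ler_piMr ?normc_ge0//; exact: gB.
rewrite /kcoef (ev_sum _ cB z1); apply: eq_bigr => j _.
by rewrite (evZ _ (gB j) z1) ev_geometric ?normcJE.
Qed.

Lemma szego_comb_gram c l : szego_comb c (a l) = (szego_gram *m c) l 0.
Proof. by rewrite mxE; apply: eq_bigr => j _; rewrite mxE mulrC. Qed.

(** The reproducing property of the Szego kernels, as a limit of truncated inner products. *)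
Lemma tends_dot_kcoef c B f : cbounded B f ->
  tends (fun N => \sum_(n < N) (kcoef c n)^* * f n)
        (\sum_j (c j 0)^* * ev f (a j)).
Proof.
move=> fB.
have h j : tends (fun N => (c j 0)^* * psum f (a j) N) ((c j 0)^* * ev f (a j)).
  exact/tendsZ/ev_tends.
apply: tends_eq (tends_sum _ h) => N; rewrite /psum.
under eq_bigr do rewrite mulr_sumr.
rewrite exchange_big/=; apply: eq_bigr => n _.
rewrite /kcoef rmorph_sum mulr_suml; apply: eq_bigr => j _.
by rewrite rmorphM rmorphXn /= conjCK -mulrA [f n * _]mulrC.
Qed.

Lemma quad_gram c :
  \sum_j (c j 0)^* * ev (kcoef c) (a j) = (c ^t* *m szego_gram *m c) 0 0.
Proof.
rewrite -mulmxA mxE; apply: eq_bigr => j _.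
by rewrite ev_kcoef// szego_comb_gram !mxE.
Qed.

Lemma tends_sum_kcoef_sq c :
  tends (fun N => (\sum_(n < N) normc (kcoef c n) ^+ 2)%:C%C)
        ((c ^t* *m szego_gram *m c) 0 0).
Proof.
rewrite -quad_gram; apply: tends_eq (tends_dot_kcoef c (kcoef_bounded c)) => N.
by rewrite rmorph_sum; apply: eq_bigr => n _; rewrite /= normc_sqrE mulrC.
Qed.

(* A function vanishing at the points a_j is orthogonal to their kernels. *)
Lemma pythagoras_kcoef c B f (e : R) : cbounded B f ->
  (forall l, ev f (a l) = 0) ->
  0 < e -> exists K, forall N, (K <= N)%N ->
  `|\sum_(n < N) normc (f n + kcoef c n) ^+ 2
    - (\sum_(n < N) normc (f n) ^+ 2
       + re ((c ^t* *m szego_gram *m c) 0 0))| < e.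
Proof.
move=> fB f0 e0; have := tends_dot_kcoef c fB.
rewrite big1 => [h|j _]; last by rewrite f0 mulr0.
have [K Kh] := tendsD (tends_sum_kcoef_sq c) (tendsZ 2 h) e0.
exists K => N /Kh; apply: le_lt_trans; rewrite mulr0 addr0.
rewrite (le_trans _ (ler_Re_normc _))// ReD ReN ReD.
set q := re (_ 0 0).
have -> : \sum_(n < N) normc (f n + kcoef c n) ^+ 2
  = \sum_(n < N) normc (f n) ^+ 2 + \sum_(n < N) normc (kcoef c n) ^+ 2
    + 2 * re (\sum_(n < N) (kcoef c n)^* * f n).
  rewrite Re_sum mulr_sumr -!big_split; apply: eq_bigr => n _ /=.
  by rewrite [in LHS]addrC normc_sqrD [X in X + _]addrC.
have -> : re (2 * \sum_(n < N) (kcoef c n)^* * f n)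
    = 2 * re (\sum_(n < N) (kcoef c n)^* * f n).
  by rewrite !mulr_natl !mulr2n ReD.
by rewrite le_eqVlt; apply/orP; left; apply/eqP; congr `|_|; rewrite /=; ring.
Qed.

Lemma l2le_add_kcoef c t f : l2le t f -> (forall l, ev f (a l) = 0) ->
  l2le (t + re ((c ^t* *m szego_gram *m c) 0 0)) (fun n => f n + kcoef c n).
Proof.
move=> ft f0; set q := re _; pose s N := \sum_(n < N) normc (f n + kcoef c n)
  ^+ 2
   - \sum_(n < N) normc (f n) ^+ 2.
apply: (@l2le_lim _ _ _ s).
  by move=> N; rewrite /s addrCA lerDl subr_ge0.
move=> e e0; have [K Kh] := pythagoras_kcoef c (l2le_bounded ft) f0 e0.
exists K => n /Kh; rewrite ltr_norml => /andP[_]; rewrite -/q /s; lra.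
Qed.

Lemma l2le_sub_kcoef c t f : l2le t (fun n => f n + kcoef c n) ->
  (forall l, ev f (a l) = 0) ->
  l2le (t - re ((c ^t* *m szego_gram *m c) 0 0)) f.
Proof.
move=> ft f0; set q := re _; pose s N := \sum_(n < N) normc (f n) ^+ 2
   - \sum_(n < N) normc (f n + kcoef c n) ^+ 2.
apply: (@l2le_lim _ _ _ s).
  by move=> N; rewrite /s addrCA lerDl subr_ge0.
have fB : cbounded (Num.sqrt t + \sum_j normc (c j 0)) f.
  move=> n; rewrite -[f n](addrK (kcoef c n)) (le_trans (ler_normcB _ _))//.
  by rewrite lerD ?kcoef_bounded ?(l2le_bounded ft).
move=> e e0; have [K Kh] := pythagoras_kcoef c fB f0 e0.
exists K => n /Kh; rewrite ltr_norml => /andP[+ _]; rewrite -/q /s; lra.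
Qed.

Lemma kcoef_eq0 c : injective a -> (forall n, kcoef c n = 0) -> c = 0.
Proof.
move=> aI k0.
have P0 (p : {poly R[i]}) : \sum_j c j 0 * p.[(a j)^*] = 0.
  under eq_bigr do rewrite horner_coef mulr_sumr.
  rewrite exchange_big/= big1// => i _.
  under eq_bigr do rewrite mulrCA.
  by rewrite -mulr_sumr -/(kcoef c i) k0 mulr0.
apply/matrixP => j j0; rewrite (ord1 j0) mxE.
have := P0 (\prod_(l | l != j) ('X - (a l)^*%:P)).
rewrite (bigD1 j)//= [X in _ + X]big1 ?addr0; last first.
  move=> i ij; rewrite (bigD1 i)//= hornerM hornerXsubC subrr mul0r mulr0.
  by [].
move/eqP; rewrite mulf_eq0 => /orP[/eqP//|];
  rewrite horner_prod => /prodf_eq0[i ij].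
 rewrite hornerXsubC subr_eq0 => /eqP.
by move=> /(can_inj conjCK)/aI ji; rewrite ji eqxx in ij.
Qed.

(** The quadratic form is the squared norm of a combination of kernels. As a limit of real partial
    sums it is real, and one nonzero coefficient bounds it away from 0. *)
Lemma szego_gram_posdef : injective a -> posdefmx szego_gram.
Proof.
move=> aI; split.
  rewrite hermsymmxE; apply/eqP/matrixP => l j; rewrite !mxE.
  by rewrite fmorphV rmorphB rmorph1 rmorphM /= conjCK mulrC.
move=> c c0; set q := (_ 0 0); have qs := tends_sum_kcoef_sq c.
have [n kn] : exists n, kcoef c n != 0.
  apply/not_existsP => k0; move/eqP: c0; apply; apply: kcoef_eq0 => // n.
  by apply/eqP; rewrite -[_ == _]negbK; apply/negP; exact: k0.
have imq : im q = 0.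
  apply/eqP; rewrite -normr_eq0 eq_le normr_ge0 andbT.
  apply/ler_addgt0Pr => e /qs[K /(_ _ (leqnn _)) h]; rewrite add0r.
  rewrite (le_trans _ (ltW h))// (le_trans _ (ler_Im_normc _))//.
  by rewrite ImD ImN -/q /= add0r normrN.
rewrite ltcE/= imq eqxx/=; apply: (@lt_le_trans _ _ (normc (kcoef c n) ^+ 2)).
  by rewrite exprn_gt0// normc_gt0.
apply/ler_addgt0Pr => e /qs[K /(_ (K + n.+1)%N (leq_addr _ _)) h].
rewrite -lerBlDl (le_trans _ (ltW h))// (le_trans _ (ler_Re_normc _))//.
rewrite (le_trans _ (ler_norm _))// ReD ReN /= lerD2r.
rewrite addnC big_split_ord/= big_ord_recr/= -addrA addrCA lerDl addr_ge0//.
  by apply: sumr_ge0 => i _; exact: sqr_ge0.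
by apply: sumr_ge0 => i _; exact: sqr_ge0.
Qed.

Lemma kernel_resolvent z : normc z < 1 ->
  (const_mx 1 : 'rV[R[i]]_M) *m invmx (1%:M - z *: diag_mx (\row_j (a j)^*))
  = \row_j (1 - z * (a j)^*)^-1.
Proof.
move=> z1; set D := _ - _; set r := \row_j _.
have DE : D = diag_mx (\row_j (1 - z * (a j)^*)).
  apply/matrixP => i j; rewrite !mxE; case: eqVneq => [->|_].
    by rewrite !mulr1n.
  by rewrite !mulr0n mulr0 subr0.
have Du : D \in unitmx.
  rewrite DE unitmxE det_diag unitfE; apply/prodf_neq0 => j _; rewrite mxE.
  exact: blaschke_den.
suff -> : const_mx 1 = r *m D by rewrite mulmxK.
rewrite DE mul_mx_diag; apply/rowP => j; rewrite !mxE mulVf//.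
exact: blaschke_den.
Qed.

Lemma szego_comb_mulmx z c : normc z < 1 ->
  ((const_mx 1 : 'rV[R[i]]_M) *m invmx (1%:M - z *: diag_mx (\row_j (a j)^*))
   *m c) 0 0 = szego_comb c z.
Proof.
move=> z1; rewrite kernel_resolvent// mxE; apply: eq_bigr => j _.
by rewrite mxE mulrC.
Qed.

End Kernels.

(** * The decomposition of the Hardy space along powers of b *)

Section SquaredNorm.
Context {R : realType} {n : nat}.
Implicit Types x y : 'cV[R[i]]_n.

Definition sqnorm x : R := \sum_i normc (x i 0) ^+ 2.

Lemma sqnorm_ge0 x : 0 <= sqnorm x.
Proof. by apply: sumr_ge0 => i _; exact: sqr_ge0. Qed.

Lemma normc_le_sqnorm x i : normc (x i 0) ^+ 2 <= sqnorm x.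
Proof.
by rewrite /sqnorm (bigD1 i)//= lerDl sumr_ge0// => j _; exact: sqr_ge0.
Qed.

Lemma enorm_le1 x : (enorm x <= 1) = (sqnorm x <= 1).
Proof.
by rewrite /enorm -[X in _ <= X]sqrtr1 ler_sqrt.
Qed.

Definition dot x y : R[i] := \sum_i (x i 0)^* * y i 0.

Lemma sqnormDZ x y (w : R[i]) : sqnorm (x + w *: y) =
  sqnorm x + normc w ^+ 2 * sqnorm y + 2 * re (w * dot x y).
Proof.
rewrite /sqnorm /dot !mulr_sumr Re_sum mulr_sumr -!big_split.
apply: eq_bigr => i _; rewrite !mxE normc_sqrD normcM exprMn /=.
by congr (_ + 2 * re _); exact: mulrCA.
Qed.

(** Cauchy-Schwarz with a free weight s: it holds term by term, so it adds up over families of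
    vectors without square roots. *)
Lemma dot_bound x y (s : R) : 0 < s ->
  2 * normc (dot x y) <= s * sqnorm x + sqnorm y / s.
Proof.
move=> s0; rewrite /sqnorm mulr_sumr mulr_suml -big_split/=.
rewrite (le_trans (ler_wpM2l _ (ler_normc_sum _ _ _)))// mulr_sumr.
apply: ler_sum => i _; rewrite normcM normcJE.
move: (normc (x i 0)) (normc (y i 0)) => p q.
rewrite -subr_ge0.
have -> : s * p ^+ 2 + q ^+ 2 / s - 2 * (p * q) = (s * p - q) ^+ 2 / s.
  by field; rewrite gt_eqF.
by rewrite divr_ge0 ?sqr_ge0// ltW.
Qed.

End SquaredNorm.

Section Decomposition.
Local Open Scope sesquilinear_scope.
Context {R : realType} {M : nat}.
Context (a : 'I_M -> R[i]) (S : 'M[R[i]]_M).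
Context (M0 : (0 < M)%N) (aI : injective a) (a1 : forall l, normc (a l) < 1).
Context (S_posdef : posdefmx S) (SS : S *m S = szego_gram a).
Implicit Types (c x : 'cV[R[i]]_M) (f g h : nat -> R[i]) (z : R[i]) (t B : R).

Local Notation P := (szego_gram a).

Definition blaschke_prod z := \prod_(l < M) blaschke (a l) z.

Local Notation b := blaschke_prod.

Let Su : S \in unitmx. Proof. exact: posdef_unitmx. Qed.

Definition normalized_kernel x z := szego_comb a (invmx S *m x) z.

Local Notation K := normalized_kernel.

(** Since P = S S with S Hermitian, the factor S^-1 makes the kernels orthonormal. *)
Lemma gram_sqnorm x :
  re (((invmx S *m x) ^t* *m P *m (invmx S *m x)) 0 0) = sqnorm x.
Proof.
have SH : S ^t* = S by apply/esym/eqP; rewrite -hermsymmxE; case: S_posdef.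
have E : (invmx S *m x) ^t* *m S = x ^t* by rewrite -{2}SH -trmxC_mul mulKVmx.
rewrite -mulmxA -SS -[S *m S *m _]mulmxA mulKVmx// mulmxA E mxE Re_sum.
by apply: eq_bigr => i _; rewrite !mxE mulrC -normc_sqrRe.
Qed.

(** As M > 0 there is at least one factor, and it makes the inequality strict. *)
Lemma blaschke_prod_lt1 z : normc z < 1 -> normc (b z) < 1.
Proof.
move=> z1.
have prod_le1 (s : seq 'I_M) : normc (\prod_(l <- s) blaschke (a l) z) <= 1.
  elim: s => [|l s IH]; first by rewrite big_nil normc1.
  by rewrite big_cons normcM mulr_ile1 ?normc_ge0// ltW// blaschke_lt1.
rewrite /blaschke_prod (bigD1 (Ordinal M0))//= normcM -big_filter.
apply: le_lt_trans (blaschke_lt1 (a1 (Ordinal M0)) z1).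
by rewrite ler_piMr ?normc_ge0.
Qed.

Lemma blaschke_prod_root l : b (a l) = 0.
Proof. by rewrite /blaschke_prod (bigD1 l)//= {1}/blaschke subrr !mul0r. Qed.

Lemma normalized_kernelE x z :
  K x z = \sum_i K (delta_mx i 0) z * x i 0.
Proof.
rewrite /normalized_kernel /szego_comb; under [RHS]eq_bigr do rewrite mulr_suml.
rewrite exchange_big/=; apply: eq_bigr => j _.
rewrite mxE mulr_suml; apply: eq_bigr => i _.
rewrite [RHS]mulrAC; congr (_ * _ / _); rewrite mxE (bigD1 i)//= big1 ?addr0.
  by rewrite mxE !eqxx mulr1.
by move=> k ki; rewrite mxE (negbTE ki) mulr0.
Qed.

(** This x makes K x interpolate h at the points a_l. The difference vanishes there, so it is
    orthogonal to the kernels and can be divided by b with no increase of norm. *)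
Lemma decomposition_step t h : l2le t h ->
  exists x g, [/\ l2le (t - sqnorm x) g,
    forall z, normc z < 1 -> ev h z = K x z + b z * ev g z &
    x = invmx S *m \col_l ev h (a l)].
Proof.
move=> ht; pose x := invmx S *m \col_l ev h (a l); exists x.
pose c := invmx S *m x; pose f n := h n - kcoef a c n.
have hB := l2le_bounded ht; have kB := kcoef_bounded a1 c.
have fE z : normc z < 1 -> ev f z = ev h z - szego_comb a c z.
  by move=> z1; rewrite (evB hB kB z1) ev_kcoef.
have Pc : P *m c = \col_l ev h (a l).
  have Sc : S *m c = x by exact: mulKVmx.
  have -> : P *m c = S *m (S *m c) by rewrite mulmxA SS.
  by rewrite Sc /x mulKVmx.
have f0 l : ev f (a l) = 0.
  by rewrite fE// szego_comb_gram Pc mxE subrr.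
have fh : (fun n => f n + kcoef a c n) = h by apply/funext => n; rewrite subrK.
have := @l2le_sub_kcoef _ _ _ a1 c t f; rewrite fh gram_sqnorm => /(_ ht f0) ft.
have [||g gt gE] := @blaschke_prod_div _ _ a a1 (index_enum 'I_M) _ _ aI _ ft.
- exact: index_enum_uniq.
- by move=> l _; exact: f0.
exists g; split=> // z z1; rewrite /blaschke_prod -gE// fE//.
by rewrite addrC subrK.
Qed.

Lemma decomposition t h : l2le t h ->
  exists x : nat -> 'cV[R[i]]_M,
    [/\ forall N, \sum_(k < N) sqnorm (x k) <= t,
      x 0%N = invmx S *m \col_l ev h (a l) &
      forall z, normc z < 1 -> tends
        (fun N => \sum_(k < N) b z ^+ k * K (x k) z) (ev h z)].
Proof.
move=> ht.
have /choice[T TP] : forall p : (nat -> R[i]) * R,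
  exists q : 'cV[R[i]]_M * (nat -> R[i]),
    l2le p.2 p.1 -> [/\ l2le (p.2 - sqnorm q.1) q.2,
      forall z, normc z < 1 -> ev p.1 z = K q.1 z + b z * ev q.2 z &
      q.1 = invmx S *m \col_l ev p.1 (a l)].
  move=> [g s]; have [gs|ngs] := pselect (l2le s g); last by exists (0, g).
  by have [x [k ?]] := decomposition_step gs; exists (x, k).
(* The state is the current remainder together with the bound left for its squared norm. *)
pose F p := ((T p).2, p.2 - sqnorm (T p).1).
pose p n := iter n F (h, t); pose x n := (T (p n)).1.
have pl n : l2le (p n).2 (p n).1 by elim: n => [//|n /TP[]].
have p2 n : (p n).2 = t - \sum_(k < n) sqnorm (x k).
  elim: n => [|n IH]; first by rewrite big_ord0 subr0.
  by rewrite big_ord_recr/= IH opprD addrA.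
have xt N : \sum_(k < N) sqnorm (x k) <= t.
  by rewrite -subr_ge0 -p2 (l2le_ge0 (pl N)).
exists x; split=> //; first by have [] := TP _ (pl 0%N).
move=> z z1; have E n : ev h z =
    \sum_(k < n) b z ^+ k * K (x k) z + b z ^+ n * ev (p n).1 z.
  elim: n => [|n ->]; first by rewrite big_ord0 add0r expr0 mul1r.
  rewrite big_ord_recr/= -addrA; congr (_ + _).
  by have [_ -> //] := TP _ (pl n); rewrite mulrDr mulrA -exprSr.
have z1' : 0 < 1 - normc z by rewrite subr_gt0.
pose D := Num.sqrt t / (1 - normc z) + 1.
have D0 : 0 < D by rewrite ltr_wpDl// divr_ge0 ?sqrtr_ge0// ltW.
move=> e e0; have [||k kb] := @expr_small _ (normc (b z)) (e / D).
- by rewrite normc_ge0 blaschke_prod_lt1.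
- by rewrite divr_gt0.
exists k => n /kb; rewrite ltr_pdivlMr// => h1.
rewrite (E n) opprD addrA subrr add0r normcNE normcM normcX
  (le_lt_trans _ h1)//.
rewrite ler_wpM2l ?exprn_ge0 ?normc_ge0//.
rewrite (le_trans (ev_bound (l2le_bounded (pl n)) z1))// /D ler_wpDr//.
rewrite ler_wpM2r ?invr_ge0 ?(ltW z1')// ler_wsqrtr// p2 gerBl.
by apply: sumr_ge0 => i _; exact: sqnorm_ge0.
Qed.

(** As in Horner's scheme, the sum is K x_0 plus b times the sum for the shifted sequence; the
    second term vanishes at the points a_l, so squared norms add. *)
Lemma synthesis_finite (x : nat -> 'cV[R[i]]_M) N :
  exists2 h, l2le (\sum_(k < N) sqnorm (x k)) h &
    forall z, normc z < 1 -> ev h z = \sum_(k < N) b z ^+ k * K (x k) z.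
Proof.
elim: N x => [|N IH] x.
  exists (fun=> 0) => [n|z z1]; first by rewrite big_ord0 big1// => k _;
    rewrite normc0 expr0n.
  by rewrite big_ord0; apply/ev_eq; apply: tends_eq (tends_cst 0) => n;
    rewrite /psum big1// => k _; rewrite mul0r.
have [g gt gE] := IH (fun k => x k.+1).
have [f ft fE] := blaschke_prod_mul a1 (index_enum 'I_M) gt.
have f0 l : ev f (a l) = 0.
  by rewrite fE// -/(b (a l)) blaschke_prod_root mul0r.
exists (fun n => f n + kcoef a (invmx S *m x 0%N) n).
  have := l2le_add_kcoef a1 (invmx S *m x 0%N) ft f0; rewrite gram_sqnorm.
  by rewrite big_ord_recl addrC.
move=> z z1; rewrite (evD (l2le_bounded ft) (kcoef_bounded a1 _) z1).
rewrite ev_kcoef// fE// -/(b z) gE// big_ord_recl expr0 mul1r addrC;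
  congr (_ + _).
by rewrite mulr_sumr; apply: eq_bigr => k _; rewrite mulrA -exprS.
Qed.

Lemma l2le_limit t (H : nat -> nat -> R[i]) (d : nat -> R[i]) :
  (forall m, l2le t (H m)) -> (forall j, tends (H^~ j) (d j)) -> l2le t d.
Proof.
move=> Ht Hd N.
have h := tends_sum (index_enum 'I_N) (fun n => tends_normc_sqr (Hd (val n))).
have := tends_Re_le h (tends_cst t%:C%C); rewrite Re_sum; apply=> m.
by rewrite Re_sum; exact: Ht.
Qed.

Lemma synthesis t (x : nat -> 'cV[R[i]]_M) :
  (forall N, \sum_(k < N) sqnorm (x k) <= t) ->
  exists2 h, l2le t h & forall z, normc z < 1 ->
    tends (fun N => \sum_(k < N) b z ^+ k * K (x k) z) (ev h z).
Proof.
move=> xt; have t0 : 0 <= t by have := xt 0%N; rewrite big_ord0.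
have /choice[H HP] : forall N, exists h, l2le (\sum_(k < N) sqnorm (x k)) h /\
    forall z, normc z < 1 -> ev h z = \sum_(k < N) b z ^+ k * K (x k) z.
  by move=> N; have [h ? ?] := synthesis_finite x N; exists h.
have Ht N : l2le t (H N) by apply: l2le_le (HP N).1.
have HB N := l2le_bounded (Ht N).
have K0 z : K 0 z = 0.
  by rewrite /K mulmx0 /szego_comb big1// => j _; rewrite mxE mul0r.
(* The difference of two finite syntheses is the synthesis of the block of indices from m to n - 1,
   so the energy of that block bounds each of its coefficients. *)
have Hdiff m n j : (m <= n)%N -> normc (H n j - H m j) ^+ 2 <=
    \sum_(k < n) sqnorm (x k) - \sum_(k < m) sqnorm (x k).
  move=> mn; pose y k := if (m <= k)%N then x k else 0.
  have split_sum (V : zmodType) (G : nat -> V) (G' : nat -> V) :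
      (forall k, (m <= k)%N -> G' k = G k) ->
        (forall k, (k < m)%N -> G' k = 0) ->
      \sum_(k < n) G' k = \sum_(k < n) G k - \sum_(k < m) G k.
    move=> GG G0; rewrite -(subnKC mn) !big_split_ord/= addrAC subrr add0r.
    rewrite big1 ?add0r => [|k _]; last by rewrite G0.
    by apply: eq_bigr => k _; rewrite GG// leq_addr.
  have [g gt gE] := synthesis_finite y n.
  have gH : g = (fun j => H n j - H m j).
    have dB : cbounded (Num.sqrt t + Num.sqrt t) (fun j => H n j - H m j).
      by move=> k; rewrite (le_trans (ler_normcB _ _))// lerD ?HB.
    apply: (@ev_inj _ _ _ _ _ 2^-1 (l2le_bounded gt) dB) => [||z z2].
    - by rewrite invr_gt0.
    - by rewrite invf_lt1// ltr1n.
    have z1 : normc z < 1 by rewrite (lt_trans z2)// invf_lt1// ltr1n.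
    rewrite (evB (HB n) (HB m) z1) gE// (HP n).2// (HP m).2//.
    apply: (split_sum _ (fun k => b z ^+ k * K (x k) z)
      (fun k => b z ^+ k * K (y k) z)) => k km; rewrite /y.
      by rewrite km.
    by rewrite leqNgt km K0 mulr0.
  have -> : H n j - H m j = g j by rewrite gH.
  rewrite -(split_sum _ (fun k => sqnorm (x k)) (fun k => sqnorm (y k))).
  - rewrite (le_trans _ (gt j.+1))// big_ord_recr/= lerDr.
    by apply: sumr_ge0 => i _; exact: sqr_ge0.
  - by move=> k km; rewrite /y km.
  - move=> k km; rewrite /y leqNgt km /sqnorm big1// => i _.
    by rewrite mxE normc0 expr0n.
have [|d [dB dj dE]] := ev_uniform_limit HB.
  move=> e e0; have e20 : 0 < e ^+ 2 by rewrite exprn_gt0.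
  have [k kx] := bounded_sum_cauchy (fun k => sqnorm_ge0 (x k)) xt e20.
  exists k => m n j km kn; rewrite -(@ltr_pXn2r _ 2) ?nnegrE ?normc_ge0
    ?(ltW e0)//.
  have [mn|/ltnW nm] := leqP m n.
    by rewrite normc_distC (le_lt_trans (Hdiff _ _ _ mn))// kx.
  by rewrite (le_lt_trans (Hdiff _ _ _ nm))// kx.
exists d => [N|z z1]; last first.
  by apply: tends_eq (dE _ z1) => N; rewrite (HP N).2.
exact: l2le_limit Ht dj N.
Qed.

(** Identifies the limit as K(z) F(b(z)), coordinate by coordinate. *)
Lemma tends_synthesis B (x : nat -> 'cV[R[i]]_M) z : normc z < 1 ->
  (forall i, cbounded B (fun k => x k i 0)) ->
  tends (fun N => \sum_(k < N) b z ^+ k * K (x k) z)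
        (\sum_i K (delta_mx i 0) z * ev (fun k => x k i 0) (b z)).
Proof.
move=> z1 xB.
have h i := tendsZ (K (delta_mx i 0) z)
  (ev_tends (xB i) (blaschke_prod_lt1 z1)).
apply: tends_eq (tends_sum _ h) => N; rewrite /psum.
under eq_bigr do rewrite mulr_sumr.
rewrite exchange_big/=; apply: eq_bigr => k _.
rewrite [in RHS]normalized_kernelE mulr_sumr; apply: eq_bigr => i _; ring.
Qed.

End Decomposition.

(** * Sarason's parametrization of the unit ball *)

Section SchurParametrization.
Context {R : realType} {m : nat}.
Implicit Types (z w : R[i]) (x : nat -> 'cV[R[i]]_m).

Lemma schur_coordP (n : nat) (s : R[i] -> 'cV[R[i]]_n) : schur s ->
  (forall i, smooth (fun z => s z i 0)) /\
  (forall z, normc z < 1 -> sqnorm (s z) <= 1).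
Proof.
move=> [sa s1]; split=> [i|z z1]; first exact: analytic_smooth.
by rewrite -enorm_le1 s1//; apply/unit_diskE.
Qed.

Lemma schur_den_neq0 z (y : R[i]) : normc z < 1 -> normc y <= 1 ->
  1 - z * y != 0.
Proof.
move=> z1 y1; apply: normc_lt1_neq0; rewrite normcM (le_lt_trans _ z1)//.
by rewrite ler_piMr ?normc_ge0.
Qed.

(* If q = 1 / (1 - z s2), then q = 1 + z s2 q, so the coefficients of s2 q are
   those of q shifted by one: contracting the first N coefficients of q
   telescopes to 1. *)
Lemma schur_to_l2 (s : R[i] -> 'cV[R[i]]_(m + 1)) : schur s ->
  exists2 x : nat -> 'cV[R[i]]_m, forall N, \sum_(k < N) sqnorm (x k) <= 1 &
    forall z, normc z < 1 -> forall i, ev (fun k => x k i 0) z =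
      s z (lshift 1 i) 0 / (1 - z * s z (rshift m 0) 0).
Proof.
move=> /schur_coordP[ss s1].
have s_le1 z i : normc z < 1 -> normc (s z i 0) <= 1.
  move=> /s1; apply: contraTT; rewrite -!ltNge => h.
  by rewrite (lt_le_trans _ (normc_le_sqnorm _ i))// exprn_egt1.
pose last : 'I_(m + 1) := rshift m 0.
(* In this form the coefficients of q are visibly 1 followed by those of T. *)
pose T z := s z last 0 / (1 - z * s z last 0); pose q z := 1 + z * T z.
have den0 z : normc z < 1 -> 1 - z * s z last 0 != 0.
  by move=> z1; rewrite schur_den_neq0// s_le1.
have sT : smooth T.
  apply: smoothM => //; apply: smoothV => //.
  apply: (@smooth_eq _ (fun z => 1 + (-1) * (z * s z last 0))).
    by move=> z _; rewrite mulN1r.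
  apply: smoothD; first exact: smooth_cst.
  by apply: smoothM; [exact: smooth_cst|apply: smoothM => //; exact: smooth_id].
have sq : smooth q.
  by apply: smoothD; [exact: smooth_cst|apply: smoothM => //; exact: smooth_id].
have qE z : normc z < 1 -> q z = (1 - z * s z last 0)^-1.
  by move=> /den0 d0; rewrite /q /T; field.
pose F i z := s z i 0 * q z.
have /choice[f fT] : forall i, exists c, taylor (F i) c.
  by move=> i; apply/smooth_taylor/smoothM.
have Tf : forall N, exists2 rho, smooth rho &
    forall z, normc z < 1 -> T z = psum (f last) z N + z ^+ N * rho z.
  move=> N; have [rho srho FE] := fT last N; exists rho => // z z1.
  by rewrite -FE /F qE.
pose c n := if n is k.+1 then f last k else 1.
have qT N : exists2 rho, smooth rho &
    forall z, normc z < 1 -> q z = psum c z N + z ^+ N * rho z.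
  case: N => [|N].
    by exists q => // z _; rewrite /psum big_ord0 add0r expr0 mul1r.
  have [rho srho TE] := Tf N; exists rho => // z z1.
  by rewrite /q TE// psumS/= mulrDr addrA exprS mulrA.
have contr N : \sum_i \sum_(n < N) normc (f i n) ^+ 2
    <= \sum_(n < N) normc (c n) ^+ 2.
  have [rho srho qE'] := qT N.
  (* Truncating q at order N changes the product s q only from order N on, so the first N
     coefficients are still those of F. *)
  apply: (@coef_contraction _ _ (fun i z => s z i 0 * psum c z N)).
    move=> i; have [rho' srho' FE] := fT i N.
    exists (fun z => rho' z + (-1) * (s z i 0 * rho z)).
      apply: smoothD => //; apply: smoothM; first exact: smooth_cst.
      exact: smoothM.
    move=> z z1; have := FE z; rewrite /F qE'// mulrDr => /eqP.
    rewrite -subr_eq => /eqP <-; ring.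
  move=> z z1; under eq_bigr do rewrite normcM exprMn.
  by rewrite -mulr_suml ler_piMl ?sqr_ge0 ?s1.
(* At N + 1 the squares of [f last] occur on both sides, N + 1 of them on the left and N on the
   right; they cancel and leave the leading 1 of q. *)
have fB N : \sum_(i < m) \sum_(n < N) normc (f (lshift 1 i) n) ^+ 2 <= 1.
  have := contr N.+1; rewrite big_split_ord/= big_ord1 -/last.
  rewrite [leRHS]big_ord_recl normc1 expr1n big_ord_recr/=.
  set A := \sum_(i < N) _; set B := \sum_(i < m) _; set D := \sum_(i < m) _.
  have BD : D <= B.
    apply: ler_sum => i _; rewrite big_ord_recr/= lerDl; exact: sqr_ge0.
  have := sqr_ge0 (normc (f last N)); lra.
exists (fun k => \col_i f (lshift 1 i) k) => [N|z z1 i].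
  rewrite /sqnorm exchange_big/= (le_trans _ (fB N))//.
  by apply: ler_sum => i _; apply: ler_sum => n _; rewrite mxE.
have -> : (fun k => (\col_i f (lshift 1 i) k) i 0) = f (lshift 1 i).
  by apply/funext => k; rewrite mxE.
rewrite -qE// -/(F _ z); apply/esym;
  apply: (taylor_ev (B := 1)) => // [n|r /andP[r0 r1]].
  have := fB n.+1; rewrite (bigD1 i)//= big_ord_recr/= => h.
  rewrite -(@expr_le1 _ 2) ?normc_ge0// (le_trans _ h)// -addrA addrCA lerDl.
  rewrite addr_ge0 ?sumr_ge0// => [k _|k _]; first exact: sqr_ge0.
  by apply: sumr_ge0 => j _; exact: sqr_ge0.
(* The denominator has modulus at least 1 - r on this circle. *)
exists (1 - r)^-1 => y yr; have y1 : normc y < 1 by rewrite yr.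
rewrite /F normcM qE// normcV -[leRHS]mul1r ler_pM ?normc_ge0 ?s_le1//.
  by rewrite invr_ge0 normc_ge0.
rewrite lef_pV2 ?posrE ?subr_gt0 ?normc_gt0 ?den0//.
have := ler_normcD (1 - y * s y last 0) (y * s y last 0).
rewrite subrK normc1 normcM yr => h.
have := ler_wpM2l (ltW r0) (s_le1 y last y1); lra.
Qed.

(** * From square summable sequences to Schur functions *)

Section OfSquareSummable.
Context (x : nat -> 'cV[R[i]]_m)
  (x1 : forall N, \sum_(k < N) sqnorm (x k) <= 1).

Let xl2 i : l2le 1 (fun k => x k i 0).
Proof.
by move=> N; rewrite (le_trans _ (x1 N))//; apply: ler_sum => k _;
  exact: normc_le_sqnorm.
Qed.

Let xB i k : cbounded 1 (fun n => x (k + n)%N i 0).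
Proof. by move=> n; have := l2le_bounded (xl2 i) (k + n)%N; rewrite sqrtr1. Qed.

Let tail_le1 k N : \sum_(n < N) sqnorm (x (k + n)%N) <= 1.
Proof.
rewrite (le_trans _ (x1 (k + N)))// big_split_ord/= lerDr.
by apply: sumr_ge0 => i _; exact: sqnorm_ge0.
Qed.

(** The value at w of T^k F, which is also the k-th coefficient of y = (1 - w T)^-1 F. *)
Let tail k w : 'cV[R[i]]_m := \col_i ev (fun n => x (k + n)%N i 0) w.

Let tail_rec k w : normc w < 1 -> tail k w = x k + w *: tail k.+1 w.
Proof.
move=> w1; apply/matrixP => i j; rewrite (ord1 j) !mxE (ev_shift (xB i k) w1).
rewrite addn0; set f := (X in ev X w); set g := (X in _ = _ + w * ev X w).
by have -> : f = g by apply/funext => n; rewrite /f /g addSnnS.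
Qed.

(** The coefficient <T^(n+1) F, F> of alpha, with the inner product cut at k < N. *)
Let corr N n : R[i] := \sum_(k < N) dot (x k) (x (k.+1 + n)%N).

Let sum_dot_bound (y z : nat -> 'cV[R[i]]_m) N (e : R) : 0 < e ->
  2 * normc (\sum_(k < N) dot (y k) (z k)) <=
  e * \sum_(k < N) sqnorm (y k) + (\sum_(k < N) sqnorm (z k)) / e.
Proof.
move=> e0; rewrite mulr_sumr mulr_suml -big_split/=.
rewrite (le_trans (ler_wpM2l _ (ler_normc_sum _ _ _)))// mulr_sumr.
by apply: ler_sum => k _; exact: dot_bound.
Qed.

Let corr_bounded N : cbounded 1 (corr N).
Proof.
move=> n; rewrite -(@ler_pM2l _ 2)// mulr1.
rewrite (le_trans (sum_dot_bound x (fun k => x (k.+1 + n)%N) N ltr01))//.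
rewrite mul1r divr1 -[2]/(1 + 1) lerD//.
rewrite (eq_bigr (fun k : 'I_N => sqnorm (x (n.+1 + k)%N))) => [|k _].
  exact: tail_le1.
by congr (sqnorm (x _)); lia.
Qed.

Let corr_cauchy (e : R) : 0 < e -> exists K, forall M N n,
  (K <= M)%N -> (K <= N)%N -> normc (corr M n - corr N n) < e.
Proof.
move=> e0; have e20 : 0 < e ^+ 2 by rewrite exprn_gt0.
have [K Kx] := bounded_sum_cauchy (fun k => sqnorm_ge0 (x k)) x1 e20; exists K.
suff h M N n : (K <= M)%N -> (M <= N)%N -> normc (corr N n - corr M n) < e.
  move=> M N n KM KN; have [MN|/ltnW NM] := leqP M N; last exact: h.
  by rewrite normc_distC h.
move=> KM MN; have := Kx M N KM MN; rewrite -(subnKC MN) /corr !big_split_ord/=.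
rewrite ![_ + _ - _]addrAC !subrr !add0r => xe.
rewrite -(@ltr_pM2l _ 2)//.
(* With weight 1 / e, the first sum is below e^2 and the second at most 1, so the bound is below 2
   e. *)
have := @sum_dot_bound (fun k => x (M + k)%N)
  (fun k => x ((M + k).+1 + n)%N) (N - M) e^-1.
rewrite invr_gt0 => /(_ e0) h; rewrite (le_lt_trans h)// invrK.
rewrite mulr_natl mulr2n ltr_leD//.
  by rewrite mulrC ltr_pdivrMr// -expr2.
rewrite ler_piMl ?(ltW e0)//.
rewrite (eq_bigr (fun k : 'I_(N - M) => sqnorm (x (M + n.+1 + k)%N))) => [|k _].
  exact: tail_le1.
by congr (sqnorm (x _)); lia.
Qed.

Let ev_corr N w : normc w < 1 -> ev (corr N) w = \sum_(k < N) dot (x k)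
  (tail k.+1 w).
Proof.
move=> w1; pose g (k : nat) i n : R[i] := (x k i 0)^* * x (k.+1 + n)%N i 0.
have gB k i : cbounded 1 (g k i).
  move=> n; rewrite normcM normcJE mulr_ile1 ?normc_ge0 ?xB//.
  by have := xB i k 0; rewrite addn0.
have dB (k : 'I_N) : cbounded m%:R (fun n => dot (x k) (x (k.+1 + n)%N)).
  move=> n; rewrite (le_trans (ler_normc_sum _ _ _))//.
  rewrite -[in leRHS](card_ord m) -sumr_const; apply: ler_sum => i _.
  exact: gB.
rewrite (ev_sum _ dB w1); apply: eq_bigr => k _.
rewrite (ev_sum _ (gB k) w1); apply: eq_bigr => i _.
by rewrite (evZ _ (xB i k.+1) w1) mxE.
Qed.

(* The energy balance of the backward shift, followed by Cauchy-Schwarz. *)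
Let energy N w : normc w < 1 ->
  sqnorm (tail 0 w) + normc (ev (corr N) w) ^+ 2 <=
  normc (1 + w * ev (corr N) w) ^+ 2 + sqnorm (tail N w).
Proof.
move=> w1; set al := ev (corr N) w.
(* The truncated squared norm of T y. *)
pose Y := \sum_(k < N) sqnorm (tail k.+1 w).
have E : sqnorm (tail 0 w) + Y = \sum_(k < N) sqnorm (x k) + normc w ^+ 2 * Y
    + 2 * re (w * al) + sqnorm (tail N w).
  have -> : sqnorm (tail 0 w) + Y = \sum_(k < N) sqnorm (tail k w) + sqnorm
    (tail N w).
    by rewrite -(@big_ord_recr _ _ _ N
      (fun k => sqnorm (tail k w))) big_ord_recl.
  congr (_ + _); rewrite /al ev_corr//
    [w * _]mulr_sumr Re_sum !mulr_sumr -!big_split/=.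
  by apply: eq_bigr => k _; rewrite (tail_rec k w1) sqnormDZ.
have Y0 : 0 <= Y by apply: sumr_ge0 => k _; exact: sqnorm_ge0.
(* Taking |al| itself as the weight gives 2 |al| <= |al| + Y / |al|. *)
have alY : normc al ^+ 2 <= Y.
  have [->|al0] := eqVneq al 0; first by rewrite normc0 expr0n.
  have nal : 0 < normc al by rewrite normc_gt0.
  have := sum_dot_bound x (fun k => tail k.+1 w) N nal;
    rewrite -ev_corr// -/al -/Y.
  move=> h; have : 2 * normc al <= normc al + Y / normc al.
    by rewrite (le_trans h)// lerD2r ler_piMr ?normc_ge0.
  rewrite mulr_natl mulr2n lerD2l ler_pdivlMr// -expr2.
have -> : normc (1 + w * al) ^+ 2
    = 1 + normc w ^+ 2 * normc al ^+ 2 + 2 * re (w * al).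
  by rewrite normc_sqrD normc1 expr1n rmorph1 mul1r normcM exprMn.
have w2 : 0 <= 1 - normc w ^+ 2 by rewrite subr_ge0 expr_le1 ?normc_ge0 ?ltW.
have := ler_wpM2l w2 alY; have := x1 N; rewrite !mulrBl !mul1r; lra.
Qed.

Let tail_small w : normc w < 1 -> tends (fun N => (sqnorm (tail N w))%:C%C) 0.
Proof.
move=> w1; have w1' : 0 < 1 - normc w by rewrite subr_gt0.
have h i : tends (fun N => tail N w i 0) 0.
  move=> e e0; have e1 : 0 < e * (1 - normc w) / 2 by rewrite divr_gt0//
    mulr_gt0.
  have [K Kx] := l2le_small (xl2 i) e1; exists K => N KN; rewrite subr0 mxE.
  have tB : cbounded (e * (1 - normc w) / 2) (fun n => x (N + n)%N i 0).
    by move=> n; rewrite ltW// Kx// (leq_trans KN)// leq_addr.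
  rewrite (le_lt_trans (ev_bound tB w1))// mulrAC mulfK ?gt_eqF//.
  by rewrite ltr_pdivrMr// mulr_natr mulr2n ltrDl.
have := tends_sum (index_enum 'I_m) (fun i => tends_normc_sqr (h i)).
rewrite big1 => [|i _]; last by rewrite normc0 expr0n.
by apply: tends_eq => N; rewrite /sqnorm rmorph_sum.
Qed.

Lemma l2_to_schur : exists2 s : R[i] -> 'cV[R[i]]_(m + 1), schur s &
  forall z, normc z < 1 -> forall i, ev (fun k => x k i 0) z =
    s z (lshift 1 i) 0 / (1 - z * s z (rshift m 0) 0).
Proof.
have [A [AB _ AE]] := ev_uniform_limit corr_bounded corr_cauchy.
pose al w := ev A w; pose d w := 1 + w * al w.
have ineq w : normc w < 1 ->
    sqnorm (tail 0 w) + normc (al w) ^+ 2 <= normc (d w) ^+ 2.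
  move=> w1; have h1 := AE w w1.
  have h2 := tendsD (tends_cst (sqnorm (tail 0 w))%:C%C) (tends_normc_sqr h1).
  have h3 := tendsD (tends_normc_sqr (tendsD (tends_cst 1) (tendsZ w h1)))
    (tail_small w1).
  have := tends_Re_le h2 h3; rewrite addr0 !ReD/=; apply => N.
  exact: energy.
(* If d w were 0, [ineq] would force al w = 0, and then d w = 1. *)
have d0 w : normc w < 1 -> d w != 0.
  move=> w1; apply/eqP => dw; have := ineq w w1.
  rewrite dw normc0 expr0n/= => h; have al0 : al w = 0.
    apply/eqP; rewrite -normc_eq0 -sqrf_eq0 eq_le sqr_ge0 andbT.
    by rewrite (le_trans _ h)// lerDr sqnorm_ge0.
  by move/eqP: dw; rewrite /d al0 mulr0 addr0 oner_eq0.
have sal : smooth al by exact: smooth_ev AB.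
have sd : smooth (fun w => (d w)^-1).
  apply: smoothV => //; apply: smoothD; first exact: smooth_cst.
  by apply: smoothM => //; exact: smooth_id.
pose s w : 'cV[R[i]]_(m + 1) := col_mx ((d w)^-1 *: tail 0 w) (const_mx
  (al w / d w)).
have su i w : s w (lshift 1 i) 0 = (d w)^-1 * tail 0 w i 0.
  by rewrite /s col_mxEu mxE.
have sl w : s w (rshift m 0) 0 = al w / d w by rewrite /s col_mxEd mxE.
have s1 w : normc w < 1 -> sqnorm (s w) <= 1.
  move=> w1; rewrite /sqnorm big_split_ord/= big_ord1 sl.
  under eq_bigr do rewrite su normcM exprMn.
  rewrite -mulr_sumr normcM [_ * normc _]mulrC exprMn -mulrDr normcV exprVn
    mulrC.
  by rewrite ler_pdivrMr ?exprn_gt0 ?normc_gt0 ?d0// mul1r ineq.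
have ss i : smooth (fun w => s w i 0).
  case: (split_ordP i) => j ->.
    apply: (@smooth_eq _ (fun w => (d w)^-1 * ev (fun n => x n j 0) w)).
      by move=> w _; rewrite su mxE.
    by apply: smoothM => //; exact: smooth_ev (xB j 0).
  rewrite (ord1 j); apply: (@smooth_eq _ (fun w => al w / d w)) => [w _|].
    by rewrite sl.
  exact: smoothM.
exists s.
  split=> [i|z /unit_diskE z1]; last by rewrite enorm_le1 s1.
  (* The return from [smooth] to analyticity goes through the global expansion of a bounded smooth
     function. *)
  have [|c cB cE] := smooth_bounded_ev (ss i); last exact: ev_analytic cB cE.
  move=> z /s1; apply: contraTT; rewrite -!ltNge => h.
  by rewrite (lt_le_trans _ (normc_le_sqnorm _ i))// exprn_egt1.
move=> z z1 i; rewrite su sl mxE; have dz := d0 z z1.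
have -> : 1 - z * (al z / d z) = (d z)^-1.
  have E : z * al z = d z - 1 by rewrite /d addrAC subrr add0r.
  by rewrite mulrA E; field.
by rewrite invrK mulrC mulrA divff// mul1r.
Qed.

End OfSquareSummable.
End SchurParametrization.

(** * The theorem *)

Section HardyBall.
Context {R : realType}.
Implicit Types (h : R[i] -> R[i]) (c : nat -> R[i]).

Lemma disk_expansionP h c : disk_expansion h c <->
  forall z, normc z < 1 -> tends (psum c z) (h z).
Proof.
split=> hc z; first by move=> /unit_diskE/hc/power_series_sumP.
by move=> /unit_diskE z1; apply/power_series_sumP; exact: hc.
Qed.

(** The coefficients of an expansion may be unbounded, so both are rescaled by 1/2 before being
    compared. *)
Lemma disk_expansion_inj h c c' :
  disk_expansion h c -> disk_expansion h c' -> c = c'.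
Proof.
move=> /disk_expansionP hc /disk_expansionP hc'.
have s0 : 0 < 2^-1 :> R by rewrite invr_gt0.
have s1 : 2^-1 < 1 :> R by rewrite invf_lt1// ltr1n.
have [B cB cE] := ev_rescale s0 s1 hc;
  have [B' cB' cE'] := ev_rescale s0 s1 hc'.
have e := ev_inj cB cB' s0 s1; apply/funext => n.
set t : R[i] := (2^-1)%:C%C in cB cE cB' cE' e *.
have t0 : t ^+ n != 0.
  by rewrite expf_neq0// -normc_gt0 normc_real normr_gt0 gt_eqF.
apply: (mulIf t0); apply: (congr1 (fun g => g n) (e _)) => z zs.
by rewrite -cE ?(lt_trans zs)// cE' ?(lt_trans zs).
Qed.

Lemma sum_sqE c N : sum_sq c N = \sum_(n < N) normc (c n) ^+ 2.
Proof. by rewrite /sum_sq /series/= big_mkord. Qed.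

Lemma sum_sq_nd c : nondecreasing_seq (sum_sq c).
Proof.
apply/nondecreasing_seqP => n; rewrite !sum_sqE big_ord_recr/= lerDl.
exact: sqr_ge0.
Qed.

(** By uniqueness the expansion chosen in [hardy2_norm] is c, and an increasing sequence has limit
    at most 1 exactly when all its terms are at most 1. *)
Lemma hardy2_ballP h : (hardy2 h /\ hardy2_norm h <= 1) <->
  exists2 c, l2le 1 c & forall z, normc z < 1 -> h z = ev c z.
Proof.
have norm_le1 c : disk_expansion h c ->
    (hardy2_norm h <= 1) = (limn (sum_sq c) <= 1).
  move=> hc; rewrite /hardy2_norm; case: xgetP => [d _ hd|/(_ c)//].
  rewrite (disk_expansion_inj hd hc) -[X in _ <= X]sqrtr1.
  by rewrite ler_sqrt.
split=> [[[c hc cvc]]|[c c1 hc]].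
  rewrite (norm_le1 c)// => l1; exists c => [N|z z1].
    rewrite -sum_sqE (le_trans _ l1)//; apply: nondecreasing_cvgn_le => //.
    exact: sum_sq_nd.
  by have /disk_expansionP/(_ z z1)/ev_eq := hc.
have ce : disk_expansion h c.
  apply/disk_expansionP => z z1; rewrite hc//.
  by apply: (ev_tends (l2le_bounded c1)).
have cvc : cvgn (sum_sq c).
  apply: nondecreasing_is_cvgn; first exact: sum_sq_nd.
  by exists 1 => _ [N _ <-]; rewrite sum_sqE.
split; first by exists c.
rewrite (norm_le1 c)//; apply: limr_le => //; near=> N; rewrite sum_sqE.
exact: c1.
Unshelve. all: by end_near. Qed.

End HardyBall.

Lemma schur_coord_bounded (R : realType) (m : nat) (x : nat -> 'cV[R[i]]_m) :
  (forall N, \sum_(k < N) sqnorm (x k) <= 1) ->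
  forall i, cbounded 1 (fun k => x k i 0).
Proof.
move=> x1 i k; rewrite -(@expr_le1 _ 2) ?normc_ge0//.
rewrite (le_trans (normc_le_sqnorm _ i))// (le_trans _ (x1 k.+1))//.
rewrite big_ord_recr/= lerDr; apply: sumr_ge0 => j _; exact: sqnorm_ge0.
Qed.

Theorem proposition6p1 (R : realType) (M : nat) (hM : (0 < M)%N)
  (a : 'I_M -> R[i]) (a_inj : injective a)
  (a_disk : forall l, unit_disk (a l))
  (u : 'rV[R[i]]_M) (gamma : R[i]) (h : R[i] -> R[i]) :
  let b (z : R[i]) := \prod_(l < M) ((z - a l) / (1 - z * (a l)^*)) in
  let C : 'rV[R[i]]_M := const_mx 1 in
  let A : 'M[R[i]]_M := diag_mx (\row_j (a j)^*) in
  let P : 'M[R[i]]_M := \matrix_(l, j) (1 - a l * (a j)^*)^-1 in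
  let sqrtP := posdef_sqrtmx P in
  [/\ hardy2 h,
      \sum_(l < M) u 0 l * h (a l) = gamma
    & hardy2_norm h <= 1]
  <->
  exists sigma : R[i] -> 'cV[R[i]]_(M + 1),
    let sigma1 (z : R[i]) : 'cV[R[i]]_M := usubmx (sigma z) in
    let sigma2 (z : R[i]) : R[i] := dsubmx (sigma z) 0 0 in
    [/\ schur sigma,
        (row_mx (u *m sqrtP) 0 *m sigma 0) 0 0 = gamma
      & forall z, unit_disk z ->
          h z = (C *m invmx (1%:M - z *: A) *m invmx sqrtP *m sigma1 (b z)) 0 0
                * (1 - b z * sigma2 (b z))^-1].
Proof.
move=> b C A P S.
have a1 l : normc (a l) < 1 by apply/unit_diskE/a_disk.
have [Sp SS] : posdefmx S /\ S *m S = szego_gram a.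
  by apply: posdef_sqrtmxP; exact: szego_gram_posdef.
have Su := posdef_unitmx Sp.
pose K := normalized_kernel a S.
have KE y z : normc z < 1 ->
    (C *m invmx (1%:M - z *: A) *m invmx S *m y) 0 0 = K y z.
  by move=> z1; rewrite -mulmxA (szego_comb_mulmx a1).
have Ka y l : K y (a l) = (S *m y) l 0.
  by rewrite /K /normalized_kernel szego_comb_gram -SS -mulmxA mulKVmx.
have b1 z : normc z < 1 -> normc (b z) < 1 := @blaschke_prod_lt1 _ _ _ hM a1 z.
have ba l : b (a l) = 0 := blaschke_prod_root a l.
have sumE (s : R[i] -> 'cV[R[i]]_(M + 1)) (x : nat -> 'cV[R[i]]_M) z :
    normc z < 1 ->
    (forall z, normc z < 1 -> forall i, ev (fun k => x k i 0) z =
      s z (lshift 1 i) 0 / (1 - z * s z (rshift M 0) 0)) ->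
    \sum_i K (delta_mx i 0) z * ev (fun k => x k i 0) (b z) =
    (C *m invmx (1%:M - z *: A) *m invmx S *m usubmx (s (b z))) 0 0
      * (1 - b z * dsubmx (s (b z)) 0 0)^-1.
  move=> z1 xs; rewrite KE// /K normalized_kernelE mulr_suml.
  by apply: eq_bigr => i _; rewrite xs ?b1// !mxE mulrA.
have dotE (y : 'cV[R[i]]_M) (v : 'I_M -> R[i]) :
    (forall l, v l = (S *m y) l 0) ->
    \sum_l u 0 l * v l = (u *m S *m y) 0 0.
  by move=> vE; rewrite -mulmxA mxE; apply: eq_bigr => l _; rewrite vE.
have rowE (w : 'cV[R[i]]_(M + 1)) :
    (row_mx (u *m S) 0 *m w) 0 0 = (u *m S *m usubmx w) 0 0.
  by rewrite -[w in LHS]vsubmxK mul_row_col mul0mx addr0.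
split=> [[hh hu hn]|[s [ss su hs]]].
  have [c c1 hc] := (hardy2_ballP h).1 (conj hh hn).
  have [x [x1 x0 xh]] := decomposition hM a_inj a1 Sp SS c1.
  have [s ss xs] := l2_to_schur x1; exists s; split=> //.
    (* The denominator is 1 at 0, so sigma_1(0) = F(0). *)
    have s0 : usubmx (s 0) = x 0%N.
      apply/matrixP => i j; rewrite (ord1 j) mxE.
      have := xs 0 _ i; rewrite normc0 ltr01 => /(_ isT).
      by rewrite ev_at0 mul0r subr0 divr1.
    rewrite rowE s0 -hu; apply/esym/dotE => l.
    by rewrite x0 mulKVmx// mxE hc.
  move=> z /unit_diskE z1; rewrite hc// -(sumE _ x)//.
  (* Both sides are limits of the same partial sums. *)
  apply: tends_unique (xh z z1) _.
  exact: (tends_synthesis S hM a1 z1 (schur_coord_bounded x1)).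
have [x x1 xs] := schur_to_l2 ss.
have [c c1 xc] := synthesis a1 Sp SS x1.
have hc z : normc z < 1 -> h z = ev c z.
  move=> z1; rewrite hs; last exact/unit_diskE.
  rewrite -(sumE _ x)//; apply: tends_unique _ (xc z z1).
  exact: (tends_synthesis S hM a1 z1 (schur_coord_bounded x1)).
have [hh hn] : hardy2 h /\ hardy2_norm h <= 1 by apply/hardy2_ballP; exists c.
split=> //; rewrite -su rowE; apply: dotE => l.
(* Since b vanishes at a_l, only sigma_1(0) enters the value there. *)
by rewrite hs// KE// ba mul0r subr0 invr1 mulr1 Ka.
Qed.
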